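(* Let $u,w\in\mathcal{D}(E)$ be such that $T=M_wEM_u$, $T(f)=wE(uf)$, is a bounded operator on $L^2(\Sigma)$, and let $0<p<\infty$. If $T$ is $p$-hyponormal and $S(E(u))=X$, then the conditional type Hölder inequality for $u,w$ turns into equality, i.e. $|E(uw)|^2=E(|u|^2)E(|w|^2)$ ($\mu$-a.e. on $X$).
   Context: $(X,\Sigma,\mu)$ is a complete $\sigma$-finite measure space and $\mathcal{A}\subseteq\Sigma$ is a sub-$\sigma$-algebra such that $\mu|_{\mathcal{A}}$ is $\sigma$-finite; functions are complex-valued, $L^2(\Sigma)=L^2(X,\Sigma,\mu)$, and all statements about functions and sets hold up to $\mu$-null sets. $L^0(\Sigma)$ (resp. $L^0(\mathcal{A})$) is the space of classes of a.e. finite-valued $\Sigma$-measurable (resp. $\mathcal{A}$-measurable) functions. The support of a measurable function $f$ is $S(f)=\{x\in X: f(x)\neq 0\}$. $E=E^{\mathcal{A}}$ is the conditional expectation with respect to $\mathcal{A}$: $E(f)$ is the unique $\mathcal{A}$-measurable function with $\int_A f\,d\mu=\int_A E(f)\,d\mu$ for all $A\in\mathcal{A}$ for nonnegative measurable $f$ (values in $[0,\infty]$, with $0\cdot\infty=0$), similarly for $f\in L^2(\Sigma)$ (for $A$ of finite measure), and extended by linearity to $\mathcal{D}(E)=\{g\in L^0(\Sigma): E(|g|)\in L^0(\mathcal{A})\}$. $M_u$, $M_w$ denote multiplication by $u$, $w$, and $M_wEM_u$ is the operator $f\mapsto wE(uf)$; boundedness on $L^2(\Sigma)$ means in particular that $uf\in\mathcal{D}(E)$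 for all $f\in L^2(\Sigma)$. A bounded operator $T$ on a Hilbert space is $p$-hyponormal ($0<p<\infty$) if $(T^*T)^p\geq (TT^* )^p$. *)

(* Defs.v *)
From HB Require Import structures.
From mathcomp Require Import all_boot all_order all_algebra.
From mathcomp Require Import complex.
From mathcomp Require Import all_classical all_reals all_analysis measurable_realfun.

Set Implicit Arguments.
Unset Strict Implicit.
Unset Printing Implicit Defensive.
Import Order.TTheory GRing.Theory Num.Theory.
Import numFieldNormedType.Exports.
Local Open Scope classical_set_scope.
Local Open Scope ring_scope.
Local Open Scope complex_scope.

(* Complex-valued functions on a measure space are represented by plain
   functions X -> R[i]; classes modulo mu-null sets are handled by stating
   every identity between functions almost everywhere. *)

Notation cmod := ComplexField.Normc.normc.

Definition cmeasurable d (X : measurableType d) (R : realType)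
    (f : X -> R[i]) : Prop :=
  measurable_fun [set: X] (fun x => complex.Re (f x)) /\
  measurable_fun [set: X] (fun x => complex.Im (f x)).

Definition supp (X : Type) (R : realType) (f : X -> R[i]) : set X :=
  [set x | f x != 0].

(* Sub-sigma-algebras. A family AA that is a sigma-algebra equals <<s AA >>,
   the measurable sets of [g_sigma_algebraType AA]; the latter has carrier X. *)

Definition is_sub_sigma_algebra d (X : measurableType d) (AA : set (set X)) :
  Prop := sigma_algebra [set: X] AA /\ AA `<=` measurable.

Definition is_sub_sigma_finite d (X : measurableType d) (R : realType)
    (mu : {measure set X -> \bar R}) (AA : set (set X)) : Prop :=
  sigma_finite [set: g_sigma_algebraType AA]
    (mu : set (g_sigma_algebraType AA) -> \bar R).

Section ConditionalExpectation.
Context d (X : measurableType d) (R : realType).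
Variables (mu : {measure set X -> \bar R}) (AA : set (set X)).

Definition is_cond_exp (f h : X -> \bar R) : Prop :=
  [/\ measurable_fun [set: g_sigma_algebraType AA]
        (h : g_sigma_algebraType AA -> \bar R),
      forall x, (0 <= h x)%E &
      forall B, AA B -> (\int[mu]_(x in B) f x = \int[mu]_(x in B) h x)%E].

(* A version of E(f), for f nonnegative and measurable. *)
Definition cond_exp (f : X -> \bar R) : X -> \bar R :=
  xget (fun=> 0%E) (is_cond_exp f).

Definition dom_cond_exp (g : X -> R[i]) : Prop :=
  cmeasurable g /\
  {ae mu, forall x, (cond_exp (fun y => (cmod (g y))%:E) x < +oo)%E}.

(* E(g) for real g, as E(g^+) - E(g^-); meaningful when E(|g|) < +oo a.e. *)
Definition rcond_exp (g : X -> R) (x : X) : R :=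
  fine (cond_exp (fun y => (Num.max (g y) 0)%:E) x) -
  fine (cond_exp (fun y => (Num.max (- g y) 0)%:E) x).

(* E(g) for g in [dom_cond_exp]. *)
Definition ccond_exp (g : X -> R[i]) (x : X) : R[i] :=
  rcond_exp (fun y => complex.Re (g y)) x +i*
  rcond_exp (fun y => complex.Im (g y)) x.

Definition MwEMu (w u : X -> R[i]) (f : X -> R[i]) : X -> R[i] :=
  fun x => w x * ccond_exp (fun y => u y * f y) x.

End ConditionalExpectation.

Section HilbertSpaceL2.
Context d (X : measurableType d) (R : realType).
Variable mu : {measure set X -> \bar R}.
Implicit Types (f g : X -> R[i]) (A B S T : (X -> R[i]) -> (X -> R[i])).

Definition L2 f : Prop :=
  cmeasurable f /\ (\int[mu]_x ((cmod (f x)) ^+ 2)%:E < +oo)%E.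

Definition cintegral f : R[i] :=
  (\int[mu]_x complex.Re (f x)) +i* (\int[mu]_x complex.Im (f x)).

Definition L2inner f g : R[i] := cintegral (fun x => f x * (g x)^*).

Definition L2norm f : R := Num.sqrt (\int[mu]_x (cmod (f x)) ^+ 2).

Definition op_bound T (K : R) : Prop :=
  0 <= K /\ forall f, L2 f -> L2norm (T f) <= K * L2norm f.

(* T induces a bounded linear operator on the space of classes of L2. *)
Definition bounded_operator T : Prop :=
  [/\ forall f, L2 f -> L2 (T f),
      forall f g, L2 f -> L2 g -> f = g %[ae mu] -> T f = T g %[ae mu],
      forall (a : R[i]) f g, L2 f -> L2 g ->
        T (fun x => a * f x + g x) = (fun x => a * T f x + T g x) %[ae mu] &
      exists K : R, op_bound T K].

Definition opnorm T : R := inf [set K | op_bound T K].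

Definition is_adjoint T S : Prop :=
  bounded_operator S /\
  forall f g, L2 f -> L2 g -> L2inner (T f) g = L2inner f (S g).

Definition op_poly (q : {poly R}) A : (X -> R[i]) -> (X -> R[i]) :=
  fun f x => \sum_(i < size q) (q`_i)%:C * iter i A f x.

(* B = A^p for a bounded positive operator A, by the continuous functional
   calculus: the spectrum of A lies in [0, ||A||], and A^p is the limit in
   operator norm of q_n(A) for polynomials q_n converging to t^p uniformly on
   [0, ||A||]. The limit does not depend on the choice of the q_n. *)
Definition is_op_power (p : R) A B : Prop :=
  bounded_operator B /\
  exists q : nat -> {poly R},
    {uniform `[0, opnorm A]%classic,
       (fun n (t : R) => (q n).[t]) @ \oo --> (fun t : R => t `^ p)} /\
    opnorm (fun f x => op_poly (q n) A f x - B f x) @[n --> \oo] --> (0 : R).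

(* Order of bounded selfadjoint operators. The order of R[i] makes
   0 <= z mean that z is real and nonnegative. *)
Definition op_le A B : Prop :=
  forall f, L2 f -> 0 <= L2inner (fun x => B f x - A f x) f.

(* The adjoint and the powers exist and are unique up to a.e. equality. *)
Definition p_hyponormal (p : R) T : Prop :=
  bounded_operator T /\
  exists S P Q, [/\ is_adjoint T S,
    is_op_power p (S \o T) P,
    is_op_power p (T \o S) Q &
    op_le Q P].

End HilbertSpaceL2.

(* Main.v *)
Require Import Defs.
From HB Require Import structures.
From mathcomp Require Import all_boot all_order all_algebra.
From mathcomp Require Import complex polyrcf.
From mathcomp Require Import ring lra.
From mathcomp Require Import all_classical all_reals all_analysis measurable_realfun.

Set Implicit Arguments.
Unset Strict Implicit.
Unset Printing Implicit Defensive.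
Import Order.TTheory GRing.Theory Num.Theory.
Import numFieldNormedType.Exports.
Local Open Scope classical_set_scope.
Local Open Scope ring_scope.
Local Open Scope complex_scope.

(** Fiberwise over AA, the operator T f = w E(u f) has rank one: it sends f to a
    multiple of w, by the inner product of f with \bar u. So T^* T and T T^* are,
    on each fiber, the same multiple E(|u|^2) E(|w|^2) of the projections onto
    \bar u and onto w. Taking powers keeps the projections, and one projection
    of rank one dominates the other only if w is a multiple of \bar u: this is
    the equality case of the conditional Cauchy-Schwarz inequality.

    p-hyponormality enters through the inclusion of ker T in ker T^*
    ([p_hyponormal_kernel]). It follows from the fact that, for B = T^* T or
    T T^*, <B^p f, f> = 0 if and only if <B f, f> = 0. The functional
    L(q) = Re <q(B) f, f> on real polynomials is nonnegative on polynomials that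
    are nonnegative on [0, b], where b is the norm of B: such a polynomial is a
    product of squares, of sums of two squares, and of factors X + a and a' - X
    with a >= 0 and a' >= b, which can be absorbed into L one at a time
    ([mf_ge0]). With q_n tending to t^p, comparing q_n with a multiple of t^N
    then bounds the moment of order N by <B^p f, f> ([mf_power_le0]).

    Given the inclusion, let A be an AA-measurable set of finite measure on which
    E(|u|^2), E(|w|^2) and E(u w) are bounded, and put
    f = 1_A (E(|u|^2) w - E(u w) \bar u). Then E(u f) = 0, so T f = 0 and f is
    orthogonal to T(1_A \bar u) = 1_A E(|u|^2) w. As E(u f) = 0 also says that f
    is orthogonal to 1_A E(u w) \bar u, f is orthogonal to itself, and
    E(|u|^2) w = E(u w) \bar u on A ([orthogonal_fiber]). Taking E(|.|^2) of both
    sides gives the equality wherever E(|u|^2) is not 0 ([local_equality]).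

    The boundedness of T yields E(|u|^2) E(|w|^2) <= K^2 for any bound K of T
    ([cond_exp_product_bound]). So the sets A cover X, up to a null set and the
    points where E(|u|^2) = 0 or E(|w|^2) = 0; there u w = 0, and both sides
    are 0.

    Conditional expectations come from the Radon-Nikodym theorem on the
    sub-sigma-algebra ([cond_expP]); they are compared through their integrals
    over AA-measurable sets ([ae_le_of_integral_le]), and AA-measurable factors
    are pulled out by monotone convergence ([integral_pull_out]). *)

(** * Positive functionals on polynomials *)

Section MomentFunctionals.
Context (R : realType).
Implicit Types (L : {poly R} -> R) (p q r s : {poly R}) (a b t : R).

(** Abstracts the functionals q |-> <q(B) f, f>, for an operator B with
    0 <= B <= b and a vector f. *)
Record moment_functional b L : Prop := MomentFunctional {
  mfD : forall p q, L (p + q) = L p + L q;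
  mfZ : forall a p, L (a *: p) = a * L p;
  mf_sq : forall s, 0 <= L (s ^+ 2);
  mfX_sq : forall s, 0 <= L ('X * s ^+ 2);
  mfbX_sq : forall s, 0 <= L ((b%:P - 'X) * s ^+ 2) }.

Lemma poly_ge0_dense (p : {poly R}) (l h a : R) : l < h -> l <= a <= h ->
  (forall t, l <= t <= h -> t != a -> 0 <= p.[t]) -> 0 <= p.[a].
Proof.
move=> lh /andP[la ah] p0; rewrite leNgt; apply/negP => pa.
have [d d0 pd] := @poly_cont R a p (- p.[a]) ltac:(lra).
have [ab|ab] := ltP a h.
- have [m1 m2] : Num.min (a + d / 2) h <= a + d / 2 /\ Num.min (a + d / 2) h <= h.
    by rewrite !ge_min !lexx orbT.
  have m3 : a < Num.min (a + d / 2) h by rewrite lt_min ab andbT; lra.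
  set m := Num.min _ _ in m1 m2 m3.
  have := pd m; have := p0 m.
  rewrite (_ : l <= m <= h); last by apply/andP; split; lra.
  rewrite gt_eqF// => /(_ isT isT) pm; rewrite ger0_norm; last lra.
  by rewrite ger0_norm; [lra|lra].
- have [m1 m2] : a - d / 2 <= Num.max (a - d / 2) l /\ l <= Num.max (a - d / 2) l.
    by rewrite !le_max !lexx orbT.
  have m3 : Num.max (a - d / 2) l < a.
    by rewrite gt_max; apply/andP; split; lra.
  set m := Num.max _ _ in m1 m2 m3.
  have := pd m; have := p0 m.
  rewrite (_ : l <= m <= h); last by apply/andP; split; lra.
  rewrite lt_eqF// => /(_ isT isT) pm; rewrite ler0_norm; last lra.
  by rewrite ger0_norm; [lra|lra].
Qed.

Section Basics.
Variables (b : R) (L : {poly R} -> R).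
Hypothesis HL : moment_functional b L.

Lemma mf_0 : L 0 = 0.
Proof. by rewrite -(scale0r 0) (mfZ HL) mul0r. Qed.

Lemma mfN p : L (- p) = - L p.
Proof. by rewrite -scaleN1r (mfZ HL) mulN1r. Qed.

Lemma mfB p q : L (p - q) = L p - L q.
Proof. by rewrite (mfD HL) mfN. Qed.

Lemma mf1_ge0 : 0 <= L 1.
Proof. by rewrite -(expr1n _ 2); exact: (mf_sq HL). Qed.

End Basics.

(** The argument behind each of the Cauchy-Schwarz inequalities below. *)
Lemma discriminant_le0 (x y z : R) : 0 <= x ->
  (forall a, 0 <= x - 2 * a * y + a ^+ 2 * z) -> y ^+ 2 <= x * z.
Proof.
move=> x0 H; have [z0|z0] := ltP 0 z; last first.
  have [y0|y0] := eqVneq y 0.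
    have := H 1; have [->|zn] := eqVneq z 0; first by rewrite y0; nra.
    have z1 : z < 0 by rewrite lt_neqAle zn.
    move=> _; have := H ((x + 1) / - z + 1); rewrite y0.
    set c := (x + 1) / - z + 1 => h.
    have c1 : (c - 1) * - z = x + 1.
      by rewrite /c addrK divfK// oppr_eq0.
    have c2 : 0 <= c - 1 by rewrite /c addrK divr_ge0; lra.
    by exfalso; nra.
  have := H ((x + 1) / (2 * y)); set c := (x + 1) / _ => h.
  have c1 : 2 * c * y = x + 1.
    by rewrite /c; field.
  by exfalso; nra.
have := H (y / z); set c := y / z => h.
have c1 : c * z = y by rewrite /c divfK// gt_eqF.
have : 0 <= z * (x - 2 * c * y + c ^+ 2 * z) by rewrite mulr_ge0// ltW.
have -> : z * (x - 2 * c * y + c ^+ 2 * z) =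
  x * z - 2 * (c * z) * y + (c * z) ^+ 2 by ring.
by rewrite c1; nra.
Qed.

Lemma mf_cauchy_schwarz b L s (t : {poly R}) : moment_functional b L ->
  L (s * t) ^+ 2 <= L (s ^+ 2) * L (t ^+ 2).
Proof.
move=> HL; apply: discriminant_le0; first exact: (mf_sq HL).
move=> a; have := mf_sq HL (s - a *: t).
rewrite sqrrB (mfD HL) (mfB HL) exprZn (mfZ HL) -scalerAr -scaler_nat scalerA.
by rewrite (mfZ HL).
Qed.

Lemma mfX_cauchy_schwarz b L s (t : {poly R}) : moment_functional b L ->
  L ('X * (s * t)) ^+ 2 <= L ('X * s ^+ 2) * L ('X * t ^+ 2).
Proof.
move=> HL; apply: discriminant_le0; first exact: (mfX_sq HL).
move=> a; have := mfX_sq HL (s - a *: t).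
rewrite sqrrB mulrDr mulrBr (mfD HL) (mfB HL) exprZn -!scalerAr (mfZ HL).
by rewrite -scaler_nat scalerA -scalerAr (mfZ HL).
Qed.

(** This is |B g|^2 <= b <B g, g>, for g = s(B) f. Cauchy-Schwarz for the form
    (s, t) |-> L(X s t), at s and X s, bounds the square of the left-hand side
    by L(X s^2) L(X^3 s^2), and the last factor is at most b L(X^2 s^2). *)
Lemma mfXX_sq b L s : 0 <= b -> moment_functional b L ->
  L ('X * ('X * s ^+ 2)) <= b * L ('X * s ^+ 2).
Proof.
move=> b0 HL; have := mfX_cauchy_schwarz s ('X * s) HL.
have -> : 'X * (s * ('X * s)) = 'X * ('X * s ^+ 2) by ring.
have x0 := mfX_sq HL s; have y0 := mf_sq HL ('X * s).
have := mfbX_sq HL ('X * s); rewrite mulrBl mul_polyC (mfB HL) (mfZ HL).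
rewrite (_ : ('X * s) ^+ 2 = 'X * ('X * s ^+ 2)) in y0 *; last by ring.
set x := L ('X * s ^+ 2) in x0 *; set y := L _ in y0 *.
set z := L ('X * ('X * ('X * s ^+ 2))) => zy yx.
have yxb : y ^+ 2 <= x * (b * y).
  by apply: le_trans yx _; rewrite ler_wpM2l//; lra.
have [->|yn] := eqVneq y 0; first by rewrite mulr_ge0.
have y1 : 0 < y by rewrite lt_neqAle eq_sym yn.
by rewrite -(ler_pM2r y1); lra.
Qed.

(** The class of moment functionals on [0, b] is a convex cone that is stable
    under precomposition with multiplication by these polynomials, hence by
    all their products: this replaces the fact that a product of commuting
    positive operators is positive. *)
Definition mf_multiplier b p := forall L,
  moment_functional b L -> moment_functional b (fun q => L (p * q)).

Lemma mf_multiplierX b : 0 <= b -> mf_multiplier b 'X.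
Proof.
move=> b0 L HL; split.
- by move=> p q; rewrite mulrDr (mfD HL).
- by move=> a q; rewrite -scalerAr (mfZ HL).
- by move=> s; apply: (mfX_sq HL).
- by move=> s; rewrite mulrA -expr2 -exprMn; apply: (mf_sq HL).
- move=> s; rewrite mulrCA mulrBl mul_polyC (mfB HL) (mfZ HL) subr_ge0.
  exact: mfXX_sq.
Qed.

Lemma mf_multiplierBX b : 0 <= b -> mf_multiplier b (b%:P - 'X).
Proof.
move=> b0 L HL; split.
- by move=> p q; rewrite mulrDr (mfD HL).
- by move=> a q; rewrite -scalerAr (mfZ HL).
- by move=> s; apply: (mfbX_sq HL).
- move=> s; rewrite mulrBl mul_polyC (mfB HL) (mfZ HL) subr_ge0.
  exact: mfXX_sq.
- by move=> s; rewrite mulrA -expr2 -exprMn; apply: (mf_sq HL).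
Qed.

Lemma mf_multiplier_sq b r : mf_multiplier b (r ^+ 2).
Proof.
move=> L HL; split.
- by move=> p q; rewrite mulrDr (mfD HL).
- by move=> a q; rewrite -scalerAr (mfZ HL).
- by move=> s; rewrite -exprMn; apply: (mf_sq HL).
- by move=> s; rewrite mulrCA -exprMn; apply: (mfX_sq HL).
- by move=> s; rewrite mulrCA -exprMn; apply: (mfbX_sq HL).
Qed.

Lemma mf_multiplierC b (c : R) : 0 <= c -> mf_multiplier b c%:P.
Proof.
move=> c0; rewrite -(sqr_sqrtr c0) rmorphXn; exact: mf_multiplier_sq.
Qed.

Lemma mf_multiplierD b p q :
  mf_multiplier b p -> mf_multiplier b q -> mf_multiplier b (p + q).
Proof.
move=> Hp Hq L HL; have [hp hq] := (Hp _ HL, Hq _ HL).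
have E r : L ((p + q) * r) = L (p * r) + L (q * r).
  by rewrite mulrDl (mfD HL).
split => [r1 r2|a r|s|s|s]; rewrite !E.
- by rewrite (mfD hp) (mfD hq) addrACA.
- by rewrite (mfZ hp) (mfZ hq) mulrDr.
- by rewrite addr_ge0// ?(mf_sq hp)// ?(mf_sq hq).
- by rewrite addr_ge0// ?(mfX_sq hp)// ?(mfX_sq hq).
- by rewrite addr_ge0// ?(mfbX_sq hp)// ?(mfbX_sq hq).
Qed.

(** A non-real root x + iy comes with its conjugate, and (X - x)^2 + y^2 is the
    product of the two linear factors. *)
Lemma real_poly_factor r : (1 < size r)%N ->
  (exists a q, r = ('X - a%:P) * q) \/
  (exists (x y : R) q, y != 0 /\ r = (('X - x%:P) ^+ 2 + (y ^+ 2)%:P) * q).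
Proof.
move=> sr.
have : size (map_poly (real_complex R) r) != 1%N.
  by rewrite size_map_poly neq_ltn sr orbT.
move=> /closed_rootP[[x y]] rz.
have [y0|y0] := eqVneq y 0.
  left; exists x.
  move: rz; rewrite y0 complexr0 fmorph_root => /factor_theorem[q ->].
  by exists q; rewrite mulrC.
right; exists x, y.
set g := ('X - x%:P) ^+ 2 + (y ^+ 2)%:P.
have sg : size g = 3%N.
  rewrite /g size_polyDl; last first.
    by rewrite size_exp_XsubC (leq_ltn_trans (size_polyC_leq1 _)).
  by rewrite size_exp_XsubC.
exists (divp r g); split => //.
suff : modp r g = 0 by rewrite {2}(divp_eq r g) => ->; rewrite addr0 mulrC.
have sm : (size (modp r g) <= 2)%N.
  by rewrite -ltnS -sg ltn_modp -size_poly_gt0 sg.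
have gz : root (map_poly (real_complex R) g) (x +i* y).
  rewrite /root /g rmorphD rmorphXn/= rmorphB/= map_polyX !map_polyC/= !hornerE.
  by apply/eqP; simpc; congr (_ +i* _); ring.
have mz : root (map_poly (real_complex R) (modp r g)) (x +i* y).
  move: rz; rewrite {1}(divp_eq r g) rmorphD rmorphM/= /root !hornerE.
  by move: gz => /rootP ->; rewrite mulr0 add0r.
have mE : modp r g = ((modp r g)`_0)%:P + (modp r g)`_1 *: 'X.
  apply/polyP => -[|[|i]]; rewrite coefD coefZ coefC coefX/=;
    rewrite ?mulr0 ?mulr1 ?addr0 ?add0r//.
  by rewrite nth_default// (leq_trans sm).
move: mz; rewrite mE; set c0 := _`_0; set c1 := _`_1.
rewrite /root rmorphD/= map_polyC map_polyZ map_polyX !hornerE/= eq_complex/=.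
move=> /andP[/eqP e1 /eqP e2].
have /eqP : c1 * y = 0 by rewrite -[RHS]e2; ring.
rewrite mulf_eq0 (negbTE y0) orbF => /eqP c10.
have -> : c0 = 0 by rewrite -[RHS]e1 c10; ring.
by rewrite c10 scale0r addr0.
Qed.

(** Positivstellensatz on [0, b]: factor r over the reals and absorb the
    factors one by one into the functional. *)
Lemma mf_ge0 b : 0 < b -> forall r L, moment_functional b L ->
  (forall t, 0 <= t <= b -> 0 <= r.[t]) -> 0 <= L r.
Proof.
move=> b0 r; move: {2}(size r) (leqnn (size r)) => n.
elim: n r => [|n IH] r sr L HL r0.
  by move: sr; rewrite leqn0 size_poly_eq0 => /eqP ->; rewrite (mf_0 HL).
have [s1|s1] := leqP (size r) 1.
  have /= := r0 0; rewrite lexx ltW// => /(_ isT).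
  rewrite (size1_polyC s1) hornerC -alg_polyC (mfZ HL) => c0.
  by rewrite mulr_ge0//; exact: mf1_ge0 HL.
have step (g q : {poly R}) : r = g * q -> (1 < size g)%N -> mf_multiplier b g ->
    (forall t, 0 <= t <= b -> 0 <= q.[t]) -> 0 <= L r.
  move=> rE sg Hg q0; rewrite rE.
  apply: (IH q _ _ (Hg _ HL) q0); rewrite -ltnS.
  have rn0 : r != 0 by rewrite -size_poly_gt0 (ltn_trans _ s1).
  have [gn0 qn0] : g != 0 /\ q != 0.
    by split; apply: contra rn0 => /eqP z; rewrite rE z ?mul0r ?mulr0.
  move: sr; rewrite rE size_mul//; apply: leq_trans.
  rewrite -subn1 ltn_subRL addnC addn1 -[X in (X < _)%N]add1n addnC -addnS.
  by rewrite addnC leq_add.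
have [[a [q rE]]|[x [y [q [y0 rE]]]]] := real_poly_factor s1; last first.
  apply: (step _ _ rE).
  - rewrite size_polyDl ?size_exp_XsubC//.
    by rewrite (leq_ltn_trans (size_polyC_leq1 _)).
  - apply: mf_multiplierD; first exact: mf_multiplier_sq.
    by apply: mf_multiplierC; exact: sqr_ge0.
  - move=> t /r0; rewrite rE !hornerE pmulr_rge0//.
    by rewrite ltr_wpDl ?sqr_ge0// lt_neqAle sqr_ge0 eq_sym sqrf_eq0 y0.
have rH t : r.[t] = (t - a) * q.[t] by rewrite rE !hornerE.
have [a0|a0] := leP a 0.
  apply: (step _ _ rE); rewrite ?size_XsubC//.
    rewrite -polyCN; apply: mf_multiplierD; first exact/mf_multiplierX/ltW.
    by apply: mf_multiplierC; lra.
  have q0 t : 0 <= t <= b -> t != 0 -> 0 <= q.[t].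
    move=> tb tn0; have t0 : 0 < t by rewrite lt_neqAle eq_sym tn0; case/andP: tb.
    by have := r0 t tb; rewrite rH pmulr_rge0//; lra.
  move=> t tb; have [->|] := eqVneq t 0; last exact: q0.
  by apply: (poly_ge0_dense b0 _ q0); rewrite lexx ltW.
have [ba|ab] := leP b a.
  apply: (step (b%:P - 'X + (a - b)%:P) (- q)).
  - by rewrite rE polyCB mulrN -mulNr; congr (_ * _); ring.
  - rewrite (_ : _ + _ = - ('X - a%:P)) ?size_polyN ?size_XsubC//.
    by rewrite polyCB; ring.
  - apply: mf_multiplierD; first exact/mf_multiplierBX/ltW.
    by apply: mf_multiplierC; lra.
  have q0 t : 0 <= t <= b -> t != b -> 0 <= (- q).[t].
    move=> tb tn0; have t0 : t < b by rewrite lt_neqAle tn0; case/andP: tb.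
    have := r0 t tb; rewrite rH -mulrNN pmulr_rge0 ?hornerN//.
    by rewrite oppr_gt0; lra.
  move=> t tb; have [->|] := eqVneq t b; last exact: q0.
  by apply: (poly_ge0_dense b0 _ q0); rewrite lexx ltW.
(* r does not change sign at an interior root, which is therefore double *)
have qa : q.[a] = 0.
  apply/eqP; rewrite eq_le; apply/andP; split.
  - rewrite -oppr_ge0 -hornerN.
    apply: (poly_ge0_dense a0); rewrite ?lexx ?ltW// => t /andP[t0 ta] tna.
    have := r0 t; rewrite t0 (le_trans ta (ltW ab)) => /(_ isT).
    rewrite rH -mulrNN pmulr_rge0 ?hornerN// oppr_gt0 subr_lt0.
    by rewrite lt_neqAle tna.
  - apply: (poly_ge0_dense ab); rewrite ?lexx ?ltW// => t /andP[ta tb] tna.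
    have := r0 t; rewrite tb (le_trans (ltW a0) ta) => /(_ isT).
    by rewrite rH pmulr_rge0// subr_gt0 lt_neqAle eq_sym tna.
have /factor_theorem[q' qE] : root q a by apply/rootP.
have {}rE : r = ('X - a%:P) ^+ 2 * q' by rewrite rE qE; ring.
apply: (step _ _ rE); rewrite ?size_exp_XsubC//; first exact: mf_multiplier_sq.
have q0 t : 0 <= t <= b -> t != a -> 0 <= q'.[t].
  move=> tb tna; have := r0 t tb; rewrite rE !hornerE pmulr_rge0//.
  by rewrite lt_neqAle eq_sym sqrf_eq0 subr_eq0 tna sqr_ge0.
move=> t tb; have [->|] := eqVneq t a; last exact: q0.
by apply: (poly_ge0_dense b0 _ q0); rewrite !ltW.
Qed.

Section Power.
Variables (b p : R) (L : {poly R} -> R) (q : nat -> {poly R}) (l : R).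
Hypotheses (b0 : 0 <= b) (p0 : 0 < p) (HL : moment_functional b L).
Hypothesis q_unif : forall e : R, 0 < e ->
  \forall n \near \oo, forall t, 0 <= t <= b -> `|(q n).[t] - t `^ p| <= e.
Hypothesis q_lim : forall e : R, 0 < e -> \forall n \near \oo, `|L (q n) - l| <= e.

(** Here L is q |-> q(0) L(1), and q_n(0) tends to 0^p = 0. *)
Lemma mf_power_eq0 : L 'X = 0 -> l = 0.
Proof.
move=> LX.
have LXs s : L ('X * s) = 0.
  apply/eqP; rewrite -sqrf_eq0 eq_le sqr_ge0 andbT.
  by have := mfX_cauchy_schwarz 1 s HL; rewrite mul1r expr1n mulr1 LX mul0r.
have Lq n : L (q n) = (q n).[0] * L 1.
  have /factor_theorem[s sE] : root (q n - (q n).[0]%:P) 0.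
    by rewrite /root !hornerE subrr.
  rewrite -[in LHS](subrK (q n).[0]%:P (q n)) sE subr0 mulrC (mfD HL) LXs add0r.
  by rewrite -alg_polyC (mfZ HL).
apply/eqP; rewrite -normr_eq0 eq_le normr_ge0 andbT.
apply/ler_addgt0Pr => e e0; rewrite add0r.
have L1 : 0 <= L 1 by apply: mf1_ge0 HL.
have e1 : 0 < e / (1 + L 1) by rewrite divr_gt0// ltr_pwDl.
near \oo => n.
have h1 : `|(q n).[0] - 0 `^ p| <= e / (1 + L 1).
  by near: n; apply: filterS (q_unif e1) => m; apply; rewrite lexx.
rewrite powR0 ?gt_eqF// subr0 in h1.
have h2 : `|L (q n) - l| <= e / (1 + L 1) by near: n; exact: q_lim.
rewrite Lq in h2.
have -> : l = (q n).[0] * L 1 - ((q n).[0] * L 1 - l) by ring.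
apply: le_trans (ler_normB _ _) _; rewrite normrM.
rewrite (ger0_norm L1).
have : `|(q n).[0]| * L 1 <= e / (1 + L 1) * L 1 by rewrite ler_wpM2r.
have : e / (1 + L 1) * (1 + L 1) = e by rewrite divfK// gt_eqF// ltr_pwDl.
by move: h2; set c := e / _; lra.
Unshelve. all: end_near. Qed.

Lemma powR_lower_bound (N : nat) : 0 < b -> p <= N%:R -> forall t, 0 <= t <= b ->
  b `^ p / b ^+ N * t ^+ N <= t `^ p.
Proof.
move=> bp pN t /andP[t0 tb].
have tbI : 0 <= t / b <= 1 by rewrite ler_pdivrMr// mul1r tb andbT divr_ge0.
have -> : t `^ p = (t / b) `^ p * b `^ p.
  rewrite -powRM//; last by rewrite divr_ge0.
  by rewrite divfK// gt_eqF.
have -> : b `^ p / b ^+ N * t ^+ N = (t / b) ^+ N * b `^ p.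
  by rewrite expr_div_n; ring.
rewrite ler_wpM2r ?powR_ge0//.
have /andP[tb0 tb1] := tbI; rewrite -powR_mulrn//.
have [z|zn] := eqVneq (t / b) 0.
  rewrite z powR0 ?powR_ge0// gt_eqF// (lt_le_trans p0 pN)//.
by apply: ger_powR => //; rewrite lt_neqAle eq_sym zn tb0.
Qed.

(** As t^p dominates a multiple of t^(2^j) on [0, b], the moment of order 2^j
    vanishes; by Cauchy-Schwarz, so do those of order 2^(j-1), ..., 1. *)
Lemma mf_power_le0 : 0 < b -> l <= 0 -> L 'X = 0.
Proof.
move=> bp l0.
have [j pj] : exists j : nat, p <= (2 ^ j.+1)%:R.
  exists (Num.truncn p); apply: ltW; apply: lt_trans (truncnS_gt p) _.
  by rewrite ltr_nat ltn_expl.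
set N := (2 ^ j.+1)%N in pj; pose c := b `^ p / b ^+ N.
have c0 : 0 < c by rewrite divr_gt0 ?powR_gt0 ?exprn_gt0.
have L1 : 0 <= L 1 by apply: mf1_ge0 HL.
have LN : c * L 'X^N <= 0.
  apply/ler_addgt0Pr => e e0; rewrite add0r.
  have e1 : 0 < e / (1 + L 1) by rewrite divr_gt0// ltr_pwDl.
  near \oo => n.
  have h1 : forall t, 0 <= t <= b -> `|(q n).[t] - t `^ p| <= e / (1 + L 1).
    by near: n; exact: q_unif.
  have h2 : `|L (q n) - l| <= e / (1 + L 1) by near: n; exact: q_lim.
  have : 0 <= L (q n + (e / (1 + L 1))%:P - c *: 'X^N).
    apply: (mf_ge0 bp HL) => t tb; rewrite !hornerE.
    have := h1 t tb; have := powR_lower_bound bp pj tb.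
    by rewrite ler_distl -/c; lra.
  rewrite (mfB HL) (mfD HL) (mfZ HL) -alg_polyC (mfZ HL).
  have : e / (1 + L 1) * (1 + L 1) = e by rewrite divfK// gt_eqF// ltr_pwDl.
  by move: h2; rewrite ler_distl; set k := e / _; lra.
have sq0 i : L 'X^(2 ^ i.+1) = 0 -> L 'X^(2 ^ i) = 0.
  move=> Li; apply/eqP; rewrite -sqrf_eq0 eq_le sqr_ge0 andbT.
  have := mf_cauchy_schwarz 'X^(2 ^ i) 1 HL.
  by rewrite mulr1 -exprM -expnSr Li mul0r.
have {LN} : L 'X^(2 ^ j.+1) = 0.
  apply/eqP; rewrite eq_le; apply/andP; split.
    by move: LN; rewrite pmulr_rle0.
  by rewrite expnSr exprM; exact: (mf_sq HL).
elim: j.+1 => [|i IH]; first by rewrite expn0 expr1.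
by move=> /sq0.
Unshelve. all: end_near. Qed.

End Power.
End MomentFunctionals.
(** * Complex-valued functions *)

Section ComplexFunctions.
Context d (X : measurableType d) (R : realType).
Implicit Types (u v : X -> R[i]).

Lemma Re_mul (y z : R[i]) : complex.Re (y * z) =
  complex.Re y * complex.Re z + (- complex.Im y) * complex.Im z.
Proof. by case: y z => ? ? [? ?] /=; rewrite mulNr. Qed.

Lemma Im_mul (y z : R[i]) : complex.Im (y * z) =
  complex.Re y * complex.Im z + complex.Im y * complex.Re z.
Proof. by case: y z => ? ? [? ?]. Qed.

Lemma cmod_sq (z : R[i]) : cmod z ^+ 2 = complex.Re z ^+ 2 + complex.Im z ^+ 2.
Proof. by case: z => a b /=; rewrite sqr_sqrtr// addr_ge0 ?sqr_ge0. Qed.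

Lemma cmod_ge0 (z : R[i]) : 0 <= cmod z.
Proof. by case: z => a b /=; exact: sqrtr_ge0. Qed.

Lemma Re_le_cmod (z : R[i]) : `|complex.Re z| <= cmod z.
Proof.
rewrite -(@ler_pXn2r _ 2)// ?nnegrE ?cmod_ge0//.
by rewrite cmod_sq real_normK ?num_real// lerDl sqr_ge0.
Qed.

Lemma Im_le_cmod (z : R[i]) : `|complex.Im z| <= cmod z.
Proof.
rewrite -(@ler_pXn2r _ 2)// ?nnegrE ?cmod_ge0//.
by rewrite cmod_sq real_normK ?num_real// lerDr sqr_ge0.
Qed.

Lemma cmod_le (z : R[i]) : cmod z <= `|complex.Re z| + `|complex.Im z|.
Proof.
rewrite -(@ler_pXn2r _ 2)// ?nnegrE ?cmod_ge0 ?addr_ge0//.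
rewrite cmod_sq sqrrD !real_normK ?num_real//.
by rewrite lerD2r lerDl mulrn_wge0// mulr_ge0.
Qed.

Lemma cmod_sqM (y z : R[i]) : cmod (y * z) ^+ 2 = cmod y ^+ 2 * cmod z ^+ 2.
Proof. by rewrite ComplexField.Normc.normcM exprMn. Qed.

Lemma cmod_sq_conj (z : R[i]) : cmod z^* ^+ 2 = cmod z ^+ 2.
Proof. by rewrite !cmod_sq; case: z => a b /=; rewrite sqrrN. Qed.

Lemma cmod_sq_real (r : R) : cmod r%:C ^+ 2 = r ^+ 2.
Proof. by rewrite cmod_sq /= expr0n addr0. Qed.

Lemma mul_conj (z : R[i]) : z * z^* = (cmod z ^+ 2)%:C.
Proof.
rewrite cmod_sq; case: z => a b /=; apply/eqP; rewrite eq_complex/=.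
by apply/andP; split; apply/eqP; ring.
Qed.

Lemma measurable_cmod_sq u : cmeasurable u ->
  measurable_fun [set: X] (fun x => cmod (u x) ^+ 2).
Proof.
move=> [mr mi]; under eq_fun do rewrite cmod_sq.
by apply: measurable_funD; apply: measurable_funX.
Qed.

Lemma measurable_cmod u : cmeasurable u ->
  measurable_fun [set: X] (fun x => cmod (u x)).
Proof.
move=> mu'; have -> : (fun x => cmod (u x)) = fun x => Num.sqrt (cmod (u x) ^+ 2).
  apply/funext => x; rewrite sqrtr_sqr ger0_norm//.
  by case: (u x) => a b /=; exact: sqrtr_ge0.
have ms : measurable_fun [set: R] (@Num.sqrt R).
  by apply: continuous_measurable_fun; exact: sqrt_continuous.
exact: (measurableT_comp ms (measurable_cmod_sq mu')).
Qed.

Lemma cmeasurable_mul u v : cmeasurable u -> cmeasurable v ->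
  cmeasurable (fun x => u x * v x).
Proof.
move=> [ur ui] [vr vi]; split.
- under eq_fun do rewrite Re_mul.
  apply: measurable_funD; apply: measurable_funM => //.
  exact: measurableT_comp.
- under eq_fun do rewrite Im_mul.
  by apply: measurable_funD; exact: measurable_funM.
Qed.

Lemma cmeasurable_conj u : cmeasurable u -> cmeasurable (fun x => (u x)^*).
Proof.
move=> [ur ui]; split.
- by have -> : (fun x => complex.Re (u x)^* ) = (fun x => complex.Re (u x));
    [apply/funext => x; case: (u x)|].
- have -> : (fun x => complex.Im (u x)^* ) = (fun x => - complex.Im (u x)).
    by apply/funext => x; case: (u x).
  exact: measurableT_comp.
Qed.

Lemma cmeasurable_real (k : X -> R) : measurable_fun [set: X] k ->
  cmeasurable (fun x => (k x)%:C).
Proof. by move=> mk; split => //; exact: measurable_cst. Qed.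

Lemma funrpos_sub (f : X -> R) x : (f^\+)%R x - (f^\-)%R x = f x.
Proof.
rewrite /funrpos /funrneg; have [h|/ltW h] := leP 0 (f x).
  by rewrite max_r ?oppr_le0// subr0.
by rewrite max_l ?oppr_ge0// opprK add0r.
Qed.

Lemma indic_sq (A : set X) x : (\1_A x : R) ^+ 2 = \1_A x.
Proof. by rewrite indicE; case: (x \in A); rewrite /= ?expr1n ?expr0n. Qed.

End ComplexFunctions.

(** * The real inner product of L2 *)

Section RealInnerProduct.
Context d (X : measurableType d) (R : realType).
Variable mu : {measure set X -> \bar R}.
Implicit Types (f g h : X -> R[i]) (a : R).

(** The real part of the inner product has the same norm and is bilinear over R,
    which is enough since all the scalars that matter are real. *)
Definition rip f g : R := \int[mu]_x
  (complex.Re (f x) * complex.Re (g x) + complex.Im (f x) * complex.Im (g x)).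

Lemma Re_L2inner f g : complex.Re (L2inner mu f g) = rip f g.
Proof.
rewrite /L2inner /cintegral /rip /=; apply: eq_Rintegral => x _.
by case: (f x) (g x) => a b [c e] /=; rewrite mulrN opprK.
Qed.

Lemma ripC f g : rip f g = rip g f.
Proof. by apply: eq_Rintegral => x _; congr (_ + _); rewrite mulrC. Qed.

Lemma rip_ge0 f : 0 <= rip f f.
Proof.
by apply: Rintegral_ge0 => x _; rewrite addr_ge0// -expr2 sqr_ge0.
Qed.

Lemma L2normE f : L2norm mu f = Num.sqrt (rip f f).
Proof.
congr Num.sqrt; apply: eq_Rintegral => x _.
by rewrite cmod_sq !expr2.
Qed.

Lemma L2norm_sq f : L2norm mu f ^+ 2 = rip f f.
Proof. by rewrite L2normE sqr_sqrtr// rip_ge0. Qed.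

Lemma L2norm_ge0 f : 0 <= L2norm mu f.
Proof. exact: sqrtr_ge0. Qed.

Lemma L2_integrable_sq f : L2 mu f ->
  mu.-integrable [set: X] (EFin \o (fun x => cmod (f x) ^+ 2)).
Proof.
move=> [mf fi]; apply/integrableP; split.
  by apply/measurable_EFinP; exact: measurable_cmod_sq.
by under eq_integral do rewrite /= ger0_norm ?sqr_ge0//.
Qed.

Lemma integrable_rip f g : L2 mu f -> L2 mu g -> mu.-integrable [set: X]
  (EFin \o (fun x => complex.Re (f x) * complex.Re (g x) +
                     complex.Im (f x) * complex.Im (g x))).
Proof.
move=> Lf Lg; have [[mfr mfi] _] := Lf; have [[mgr mgi] _] := Lg.
apply: le_integrable (integrableD measurableT (L2_integrable_sq Lf)
  (L2_integrable_sq Lg)) => //.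
- apply/measurable_EFinP.
  by apply: measurable_funD; apply: measurable_funM.
- move=> x _ /=; rewrite lee_fin [leRHS]ger0_norm ?addr_ge0 ?sqr_ge0// !cmod_sq.
  set p := complex.Re (f x); set q := complex.Im (f x).
  set r := complex.Re (g x); set t := complex.Im (g x).
  have h1 := sqr_ge0 (p + r); have h2 := sqr_ge0 (q + t).
  have h3 := sqr_ge0 (p - r); have h4 := sqr_ge0 (q - t).
  have := addr_ge0 (addr_ge0 (sqr_ge0 p) (sqr_ge0 q))
    (addr_ge0 (sqr_ge0 r) (sqr_ge0 t)).
  move=> h5.
  by rewrite ler_norml; apply/andP; split; lra.
Qed.

Lemma L2_lin a f g : L2 mu f -> L2 mu g -> L2 mu (fun x => a%:C * f x + g x).
Proof.
move=> Lf Lg; have [[mfr mfi] _] := Lf; have [[mgr mgi] _] := Lg.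
have rE x : complex.Re (a%:C * f x + g x) =
    a * complex.Re (f x) + complex.Re (g x).
  by case: (f x) (g x) => ? ? [? ?] /=; rewrite mul0r subr0.
have iE x : complex.Im (a%:C * f x + g x) =
    a * complex.Im (f x) + complex.Im (g x).
  by case: (f x) (g x) => ? ? [? ?] /=; rewrite mul0r addr0.
have mfg : cmeasurable (fun x => a%:C * f x + g x).
  split; [under eq_fun do rewrite rE|under eq_fun do rewrite iE];
    by apply: measurable_funD => //; apply: measurable_funM.
split => //.
pose sf x := cmod (f x) ^+ 2; pose sg x := cmod (g x) ^+ 2.
have /integrable_lty : mu.-integrable [set: X]
    (fun x => (2 * a ^+ 2)%:E * (sf x)%:E + 2%:E * (sg x)%:E)%E.
  by apply: integrableD => //; apply: integrableZl => //; exact: L2_integrable_sq.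
move=> /(_ measurableT); apply: le_lt_trans; apply: ge0_le_integral => //.
- by move=> x _; rewrite lee_fin sqr_ge0.
- by apply/measurable_EFinP; exact: measurable_cmod_sq.
- apply: emeasurable_funD => //; apply: measurable_funeM;
    by apply/measurable_EFinP; exact: measurable_cmod_sq.
- move=> x _ /=; rewrite lee_fin /sf /sg !cmod_sq rE iE.
  have := sqr_ge0 (a * complex.Re (f x) - complex.Re (g x)).
  have := sqr_ge0 (a * complex.Im (f x) - complex.Im (g x)).
  by lra.
Qed.

Lemma L2_0 : L2 mu (fun=> 0).
Proof.
split; first by split; exact: measurable_cst.
rewrite (_ : (fun _ => _) = cst 0%E) ?integral0//.
by apply/funext => x; rewrite cmod_sq/= expr0n addr0.
Qed.

Lemma ripDZl a f g h : L2 mu f -> L2 mu g -> L2 mu h ->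
  rip (fun x => a%:C * f x + g x) h = a * rip f h + rip g h.
Proof.
move=> Lf Lg Lh; rewrite /rip -RintegralZl//; last exact: integrable_rip.
rewrite -RintegralD//; last 2 first.
- under [X in _.-integrable _ X]eq_fun do rewrite /= EFinM.
  by apply: integrableZl => //; exact: integrable_rip.
- exact: integrable_rip.
apply: eq_Rintegral => x _.
by case: (f x) (g x) (h x) => ? ? [? ?] [? ?] /=; ring.
Qed.

Lemma rip_ae f g h : L2 mu f -> L2 mu g -> L2 mu h -> f = g %[ae mu] ->
  rip f h = rip g h.
Proof.
move=> Lf Lg Lh fg; rewrite /rip /Rintegral; congr fine.
apply: ae_eq_integral => //.
- exact: measurable_int (integrable_rip Lf Lh).
- exact: measurable_int (integrable_rip Lg Lh).
- by apply: filterS fg => x /= fgx _; rewrite fgx.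
Qed.

Lemma rip0l f : rip (fun=> 0) f = 0.
Proof.
rewrite /rip /Rintegral; under eq_integral do rewrite /= !mul0r addr0.
by rewrite integral0.
Qed.

Lemma ripBl f g h : L2 mu f -> L2 mu g -> L2 mu h ->
  rip (fun x => f x - g x) h = rip f h - rip g h.
Proof.
move=> Lf Lg Lh; have -> : (fun x => f x - g x) = (fun x => (-1)%:C * g x + f x).
  by apply/funext => x; rewrite rmorphN rmorph1 mulN1r addrC.
by rewrite ripDZl// mulN1r addrC.
Qed.

Lemma L2_sub f g : L2 mu f -> L2 mu g -> L2 mu (fun x => f x - g x).
Proof.
move=> Lf Lg; have -> : (fun x => f x - g x) = (fun x => (-1)%:C * g x + f x).
  by apply/funext => x; rewrite rmorphN rmorph1 mulN1r addrC.
exact: L2_lin.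
Qed.

Lemma L2_sum n (c : nat -> R) (F : nat -> X -> R[i]) : (forall i, L2 mu (F i)) ->
  L2 mu (fun x => \sum_(i < n) (c i)%:C * F i x).
Proof.
move=> LF; elim: n => [|n IH].
  by under eq_fun do rewrite big_ord0; exact: L2_0.
by under eq_fun do rewrite big_ord_recr/= addrC; exact: L2_lin.
Qed.

Lemma rip_suml n (c : nat -> R) (F : nat -> X -> R[i]) h :
    (forall i, L2 mu (F i)) -> L2 mu h ->
  rip (fun x => \sum_(i < n) (c i)%:C * F i x) h = \sum_(i < n) c i * rip (F i) h.
Proof.
move=> LF Lh; elim: n => [|n IH].
  by under eq_fun do rewrite big_ord0; rewrite rip0l big_ord0.
under [X in rip X]eq_fun do rewrite big_ord_recr/= addrC.
by rewrite ripDZl//; [rewrite IH big_ord_recr/= addrC|exact: L2_sum].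
Qed.

Lemma rip_cauchy_schwarz_sq f g : L2 mu f -> L2 mu g ->
  rip f g ^+ 2 <= rip f f * rip g g.
Proof.
move=> Lf Lg; apply: discriminant_le0; first exact: rip_ge0.
move=> a; have := rip_ge0 (fun x => (- a)%:C * g x + f x).
rewrite ripDZl//; last exact: L2_lin.
by rewrite [rip g _]ripC [rip f _]ripC !ripDZl// (ripC g f); nra.
Qed.

Lemma rip_cauchy_schwarz f g : L2 mu f -> L2 mu g ->
  `|rip f g| <= L2norm mu f * L2norm mu g.
Proof.
move=> Lf Lg; rewrite -(@ler_pXn2r _ 2)// ?nnegrE ?mulr_ge0 ?L2norm_ge0//.
by rewrite exprMn !L2norm_sq real_normK ?num_real// rip_cauchy_schwarz_sq.
Qed.

Lemma L2norm_lin a f g : L2 mu f -> L2 mu g ->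
  L2norm mu (fun x => a%:C * f x + g x) <= `|a| * L2norm mu f + L2norm mu g.
Proof.
move=> Lf Lg; have n0 := L2norm_ge0.
rewrite -(@ler_pXn2r _ 2)// ?nnegrE ?addr_ge0 ?mulr_ge0//.
rewrite L2norm_sq ripDZl//; last exact: L2_lin.
rewrite [rip g _]ripC [rip f _]ripC !ripDZl// (ripC g f) sqrrD exprMn.
rewrite !L2norm_sq real_normK ?num_real//.
have : a * rip f g <= `|a| * L2norm mu f * L2norm mu g.
  apply: le_trans (ler_norm _) _; rewrite normrM -mulrA ler_wpM2l//.
  exact: rip_cauchy_schwarz.
by set u := _ * _ * _; nra.
Qed.

End RealInnerProduct.

(** * Powers of positive operators *)

Section OperatorPowers.
Context d (X : measurableType d) (R : realType).
Variable mu : {measure set X -> \bar R}.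
Implicit Types (f g h : X -> R[i]) (A T S : (X -> R[i]) -> X -> R[i]).

Lemma opnorm_bound T : (exists K, op_bound mu T K) ->
  op_bound mu T (opnorm mu T).
Proof.
move=> [K TK]; split.
  by apply: lb_le_inf => [|k []//]; exists K.
move=> f Lf; have [f0|f0] := eqVneq (L2norm mu f) 0.
  by have := TK.2 f Lf; rewrite f0 !mulr0.
have fp : 0 < L2norm mu f by rewrite lt_neqAle eq_sym f0 L2norm_ge0.
rewrite -ler_pdivrMr//; apply: lb_le_inf; first by exists K.
by move=> k [k0 Tk]; rewrite ler_pdivrMr//; exact: Tk.
Qed.

(** The assumption on B and C says that B = C^* C. *)
Section PositiveOperator.
Variables B C : (X -> R[i]) -> X -> R[i].
Hypotheses (BL2 : forall f, L2 mu f -> L2 mu (B f))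
  (B_bounded : exists K, op_bound mu B K)
  (BC : forall f g, L2 mu f -> L2 mu g -> rip mu (B f) g = rip mu (C f) (C g)).

Lemma selfadjoint f g : L2 mu f -> L2 mu g -> rip mu (B f) g = rip mu f (B g).
Proof. by move=> Lf Lg; rewrite BC// [RHS]ripC BC// ripC. Qed.

Lemma iter_L2 n f : L2 mu f -> L2 mu (iter n B f).
Proof. by move=> Lf; elim: n => //= n IH; exact: BL2. Qed.

Lemma op_poly_L2 q f : L2 mu f -> L2 mu (op_poly q B f).
Proof.
by move=> Lf; apply: L2_sum (fun i => q`_i) (fun i => iter i B f) _ => i;
  exact: iter_L2.
Qed.

Lemma op_poly_bounded q : exists K, op_bound mu (op_poly q B) K.
Proof.
have [K [K0 BK]] := B_bounded.
have iK n f : L2 mu f -> L2norm mu (iter n B f) <= K ^+ n * L2norm mu f.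
  move=> Lf; elim: n => [|n IH] /=; first by rewrite expr0 mul1r.
  apply: le_trans (BK _ (iter_L2 n Lf)) _.
  by rewrite exprS -mulrA ler_wpM2l.
exists (\sum_(i < size q) `|q`_i| * K ^+ i); split.
  by apply: sumr_ge0 => i _; rewrite mulr_ge0 ?exprn_ge0.
move=> f Lf; rewrite /op_poly.
elim: (size q) => [|n IH].
  rewrite big_ord0 mul0r; under [X in L2norm _ X]eq_fun do rewrite big_ord0.
  by rewrite L2normE rip0l sqrtr0.
under [X in L2norm _ X]eq_fun do rewrite big_ord_recr/= addrC.
apply: le_trans (L2norm_lin _ _ _) _.
- exact: iter_L2.
- by apply: L2_sum (fun i => q`_i) (fun i => iter i B f) _ => i; exact: iter_L2.
- rewrite big_ord_recr/= mulrDl [leRHS]addrC lerD//.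
  by rewrite -mulrA ler_wpM2l// iK.
Qed.

Section Moments.
Variables (f : X -> R[i]) (Lf : L2 mu f).
Implicit Types (q s t : {poly R}) (n i j k : nat).

Let m n := rip mu (iter n B f) f.

Definition moment (q : {poly R}) : R := rip mu (op_poly q B f) f.

Let momentE q n : (size q <= n)%N -> moment q = \sum_(i < n) q`_i * m i.
Proof.
move=> qn; rewrite /moment /op_poly.
rewrite (rip_suml _ (fun i => q`_i) (F := fun i => iter i B f))//; last first.
  by move=> i; exact: iter_L2.
rewrite -!(big_mkord xpredT (fun i => q`_i * m i)).
rewrite (big_cat_nat _ qn)//= [X in _ = _ + X]big_nat_cond.
rewrite [X in _ = _ + X]big1 ?addr0// => i; rewrite andbT => /andP[qi _].
by rewrite nth_default// mul0r.
Qed.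

Let momentD s q : moment (s + q) = moment s + moment q.
Proof.
pose n := maxn (size s) (size q).
rewrite (@momentE (s + q) n) ?size_polyD// (@momentE s n) ?leq_maxl//.
rewrite (@momentE q n) ?leq_maxr// -big_split/=.
by apply: eq_bigr => i _; rewrite coefD mulrDl.
Qed.

Let momentZ a s : moment (a *: s) = a * moment s.
Proof.
rewrite (@momentE (a *: s) (size s)) ?size_scale_leq// (@momentE s (size s))//.
by rewrite mulr_sumr; apply: eq_bigr => i _; rewrite coefZ mulrA.
Qed.

Let moment_sum (I : Type) (e : seq I) (F : I -> {poly R}) :
  moment (\sum_(i <- e) F i) = \sum_(i <- e) moment (F i).
Proof.
elim: e => [|i e IH]; last by rewrite !big_cons momentD IH.
by rewrite !big_nil -(scale0r 0) momentZ mul0r.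
Qed.

Let momentXn n : moment 'X^n = m n.
Proof.
rewrite (@momentE _ n.+1) ?size_polyXn// big_ord_recr/= coefXn eqxx mul1r.
by rewrite big1 ?add0r// => i _; rewrite coefXn ltn_eqF ?mul0r.
Qed.

Let m_split i j : rip mu (iter i B f) (iter j B f) = m (i + j).
Proof.
elim: j i => [|j IH] i; first by rewrite addn0.
rewrite iterS -selfadjoint; [|exact: iter_L2|exact: iter_L2].
by rewrite -[B (iter i B f)]/(iter i.+1 B f) IH addSnnS.
Qed.

Let momentM k s t : moment ('X^k * (s * t)) =
  \sum_(i < size s) s`_i * \sum_(j < size t) t`_j * m (k + i + j).
Proof.
rewrite -{1}(coefK s) poly_def mulr_suml mulr_sumr moment_sum.
apply: eq_bigr => i _; rewrite -scalerAl -scalerAr momentZ; congr (_ * _).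
rewrite -{1}(coefK t) poly_def !mulr_sumr moment_sum.
apply: eq_bigr => j _; rewrite -!scalerAr momentZ; congr (_ * _).
by rewrite mulrA -!exprD momentXn.
Qed.

Let ripM k s t :
  rip mu (iter k B (op_poly s B f)) (op_poly t B f) = moment ('X^k * (s * t)).
Proof.
have tr i : L2 mu (iter i B f) by exact: iter_L2.
have Ls := op_poly_L2 s Lf; have Lt := op_poly_L2 t Lf.
have shift g h : L2 mu g -> L2 mu h -> rip mu (iter k B g) h = rip mu g (iter k B h).
  move=> Lg; elim: (k) h => [//|n IH] h Lh.
  rewrite iterS selfadjoint//; last exact: iter_L2.
  by rewrite IH; [rewrite -iterSr|exact: BL2].
rewrite shift// momentM {1}/op_poly.
rewrite (rip_suml _ (fun i => s`_i) (F := fun i => iter i B f))//; last exact: iter_L2.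
apply: eq_bigr => i _; congr (_ * _); rewrite -shift// -iterD ripC /op_poly.
rewrite (rip_suml _ (fun i => t`_i) (F := fun i => iter i B f))//.
by apply: eq_bigr => j _; congr (_ * _); rewrite m_split addnC.
Qed.

(** With g = s(B) f, the values at s^2 and X s^2 are the squared norms of g and
    C g, and |<B g, g>| is at most the norm of B times the squared norm of g. *)
Lemma moment_functional_moment : moment_functional (opnorm mu B) moment.
Proof.
split => // s; have Ls := op_poly_L2 s Lf.
- by rewrite -[s ^+ 2]mul1r -(expr0 'X) expr2 -ripM; exact: rip_ge0.
- by rewrite -[X in X * _]expr1 expr2 -ripM/= BC//; exact: rip_ge0.
rewrite mulrBl mul_polyC momentD -scaleN1r !momentZ mulN1r subr_ge0.
rewrite -[in leLHS](expr1 'X) -[in leRHS](mul1r (s ^+ 2)) -(expr0 'X) expr2 -!ripM/=.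
have [_ /(_ _ Ls) Bs] := opnorm_bound B_bounded.
apply: le_trans (ler_norm _) _; apply: le_trans (rip_cauchy_schwarz _ _) _ => //.
  exact: BL2.
by rewrite -L2norm_sq expr2 mulrA ler_wpM2r// L2norm_ge0.
Qed.

Lemma momentX : moment 'X = rip mu (B f) f.
Proof. by rewrite -[in LHS](expr1 'X) momentXn. Qed.

(** Convergence in operator norm, tested at f. *)
Lemma moment_power_cvg (p : R) P : is_op_power mu p B P ->
  exists q : nat -> {poly R},
  (forall e : R, 0 < e -> \forall n \near \oo, forall x : R,
     0 <= x <= opnorm mu B -> `|(q n).[x] - x `^ p| <= e) /\
  (forall e : R, 0 < e ->
     \forall n \near \oo, `|moment (q n) - rip mu (P f) f| <= e).
Proof.
move=> [[PL2 _ _ [KP [KP0 PKP]]] [q [q_unif q_lim]]]; exists q; split => e e0.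
  pose U := [set h : R -> R | forall x, 0 <= x <= opnorm mu B ->
    `|h x - x `^ p| <= e].
  apply: (q_unif U); apply/uniform_nbhs.
  exists [set xy | ball xy.1 e xy.2]; split; first exact: entourage_ball (PosNum e0).
  move=> h /= hU x xI; rewrite distrC; apply/ltW/hU.
  by rewrite /= in_itv.
have N0 := rip_ge0 mu f.
have e1 : 0 < e / (1 + rip mu f f) by rewrite divr_gt0// ltr_pwDl.
have := q_lim => /cvgrPdist_le/(_ _ e1); apply: filterS => n.
rewrite sub0r normrN.
set D := fun f0 : X -> R[i] => _.
have [K [K0 qK]] := op_poly_bounded (q n).
have Dsub g : D g = fun x => op_poly (q n) B g x - P g x by [].
have DL2 g : L2 mu g -> L2 mu (D g).
  by move=> Lg; rewrite Dsub; apply: L2_sub; [exact: op_poly_L2|exact: PL2].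
have Dbd : exists K, op_bound mu D K.
  exists (KP + K); split; first exact: addr_ge0.
  move=> g Lg.
  have -> : D g = (fun x => (-1)%:C * P g x + op_poly (q n) B g x).
    by apply/funext => x; rewrite Dsub rmorphN rmorph1 mulN1r addrC.
  apply: le_trans (L2norm_lin _ _ _) _; [exact: PL2|exact: op_poly_L2|].
  by rewrite normrN1 mul1r mulrDl lerD ?PKP ?qK.
have [D0 DK] := opnorm_bound Dbd.
rewrite ger0_norm// => De.
rewrite /moment -ripBl//; [|exact: op_poly_L2|exact: PL2].
apply: le_trans (rip_cauchy_schwarz (DL2 _ Lf) Lf) _.
apply: (@le_trans _ _ (opnorm mu D * rip mu f f)).
  by rewrite -L2norm_sq expr2 mulrA ler_wpM2r ?L2norm_ge0// DK.
apply: (@le_trans _ _ (e / (1 + rip mu f f) * (1 + rip mu f f))).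
  by rewrite ler_pM//; lra.
by rewrite divfK// gt_eqF// ltr_pwDl.
Qed.

Lemma op_power_eq0 (p : R) P : 0 < p -> is_op_power mu p B P ->
  rip mu (B f) f = 0 -> rip mu (P f) f = 0.
Proof.
move=> p0 /moment_power_cvg[q [q_unif q_lim]] Bf.
apply: (mf_power_eq0 _ p0 moment_functional_moment q_unif q_lim).
  by have [] := opnorm_bound B_bounded.
by rewrite momentX.
Qed.

Lemma op_power_le0 (p : R) P : 0 < p -> is_op_power mu p B P ->
  rip mu (P f) f <= 0 -> rip mu (B f) f = 0.
Proof.
move=> p0 /moment_power_cvg[q [q_unif q_lim]] Pf.
have [B0 BB] := opnorm_bound B_bounded.
have [b0|b0] := eqVneq (opnorm mu B) 0.
  apply/eqP; rewrite -normr_le0; apply: le_trans (rip_cauchy_schwarz (BL2 Lf) Lf) _.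
  have := BB f Lf; rewrite b0 mul0r => Bf.
  by rewrite mulr_le0_ge0 ?L2norm_ge0.
rewrite -momentX.
apply: (mf_power_le0 B0 p0 moment_functional_moment q_unif q_lim) => //.
by rewrite lt_neqAle eq_sym b0.
Qed.

End Moments.
End PositiveOperator.

Lemma adjoint_rip T S f g : is_adjoint mu T S -> L2 mu f -> L2 mu g ->
  rip mu (T f) g = rip mu f (S g).
Proof. by move=> [_ TS] Lf Lg; rewrite -!Re_L2inner TS. Qed.

Lemma rip_eq0 f g : L2 mu f -> L2 mu g -> rip mu f f = 0 -> rip mu f g = 0.
Proof.
move=> Lf Lg f0; apply/eqP; rewrite -sqrf_eq0 eq_le sqr_ge0 andbT.
by apply: le_trans (rip_cauchy_schwarz_sq Lf Lg) _; rewrite f0 mul0r.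
Qed.

Lemma comp_bounded T S : bounded_operator mu T -> bounded_operator mu S ->
  exists K, op_bound mu (T \o S) K.
Proof.
move=> [TL2 _ _ [K [K0 TK]]] [SL2 _ _ [K' [K'0 SK]]].
exists (K * K'); split; first exact: mulr_ge0.
move=> f Lf /=; apply: le_trans (TK _ (SL2 _ Lf)) _.
by rewrite -mulrA ler_wpM2l// SK.
Qed.

(** The kernel of (T^* T)^p is that of T and the kernel of (T T^* )^p is that of
    T^*, so p-hyponormality makes the former a subspace of the latter. *)
Lemma p_hyponormal_kernel (p : R) T f g : 0 < p -> p_hyponormal mu p T ->
  L2 mu f -> T f = (fun=> 0) %[ae mu] -> L2 mu g -> rip mu (T g) f = 0.
Proof.
move=> p0 [Tb [S [P [Q [TS PE QE PQ]]]]] Lf Tf Lg.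
have [TL2 _ _ _] := Tb; have [Sb _] := TS; have [SL2 _ _ _] := Sb.
have [[PL2 _ _ _] _] := PE; have [[QL2 _ _ _] _] := QE.
have Pf0 : rip mu (P f) f = 0.
  have BC h k : L2 mu h -> L2 mu k ->
      rip mu ((S \o T) h) k = rip mu (T h) (T k).
    move=> Lh Lk; rewrite /= ripC -(adjoint_rip TS Lk (TL2 _ Lh)); exact: ripC.
  apply: (op_power_eq0 _ _ BC Lf p0 PE) => //.
  - by move=> h Lh; apply/SL2/TL2.
  - exact: comp_bounded.
  by rewrite BC// (rip_ae _ _ _ Tf) ?rip0l//; [exact: TL2|exact: L2_0|exact: TL2].
have BC h k : L2 mu h -> L2 mu k -> rip mu ((T \o S) h) k = rip mu (S h) (S k).
  by move=> Lh Lk; rewrite (adjoint_rip TS)//; exact: SL2.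
have : rip mu ((T \o S) f) f = 0.
  apply: (op_power_le0 _ _ BC Lf p0 QE) => //.
  - by move=> h Lh; apply/TL2/SL2.
  - exact: comp_bounded.
  have := PQ _ Lf; rewrite lecE => /andP[_]; rewrite Re_L2inner [complex.Re 0]/=.
  by rewrite ripBl ?Pf0 ?sub0r ?oppr_ge0//; [exact: PL2|exact: QL2].
rewrite BC// => Sf; rewrite (adjoint_rip TS)// ripC.
by apply: rip_eq0 => //; exact: SL2.
Qed.

End OperatorPowers.
(** * Conditional expectation of nonnegative functions *)

(** The restriction of mu to the sub-sigma-algebra, on the carrier of which the
    AA-measurable sets are the measurable ones. *)
Definition sub_measure d (X : measurableType d) (R : realType)
    (mu : {measure set X -> \bar R}) (AA : set (set X))
    (_ : is_sub_sigma_algebra AA) : set (g_sigma_algebraType AA) -> \bar R := mu.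

(** The measure with density g, restricted to the sub-sigma-algebra. *)
Definition sub_density d (X : measurableType d) (R : realType)
    (mu : {measure set X -> \bar R}) (AA : set (set X))
    (_ : is_sub_sigma_algebra AA) (g : X -> \bar R)
    (_ : mu.-integrable [set: X] g) (_ : forall x, (0 <= g x)%E) :
    set (g_sigma_algebraType AA) -> \bar R :=
  fun B => (\int[mu]_(x in B) g x)%E.

Section SubSigmaAlgebra.
Context d (X : measurableType d) (R : realType).
Variables (mu : {measure set X -> \bar R}) (AA : set (set X)).
Hypothesis AA_sub : is_sub_sigma_algebra AA.
Local Notation Y := (g_sigma_algebraType AA).

Lemma sub_measurableE (B : set Y) : measurable B <-> AA B.
Proof. by rewrite (measurable_g_measurableTypeE AA_sub.1). Qed.

Lemma sub_measurable (B : set Y) : measurable B -> measurable (B : set X).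
Proof. by move=> /sub_measurableE /AA_sub.2. Qed.

Lemma sub_measurable_fun d' (Z : measurableType d') (h : X -> Z) :
  measurable_fun [set: Y] (h : Y -> Z) -> measurable_fun [set: X] h.
Proof.
move=> mh _ B mB; apply: sub_measurable.
exact: (mh measurableT B mB).
Qed.

Lemma measurable_id_sub : measurable_fun [set: X] (id : X -> Y).
Proof. by move=> _ B mB; rewrite setTI; exact: sub_measurable. Qed.

Local Notation m := (sub_measure mu AA_sub).

Let m0 : m set0 = 0%E. Proof. exact: measure0. Qed.
Let m_ge0 B : (0 <= m B)%E. Proof. exact: measure_ge0. Qed.
Let m_sigma_additive : semi_sigma_additive m.
Proof.
move=> F mF tF mUF; apply: measure_semi_sigma_additive => //.
- by move=> n; exact: sub_measurable (mF n).
- exact: sub_measurable mUF.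
Qed.
HB.instance Definition _ :=
  isMeasure.Build _ _ _ m m0 m_ge0 m_sigma_additive.

Lemma integral_sub_measure (B : set Y) (h : Y -> \bar R) : measurable B ->
  measurable_fun [set: Y] h -> (forall x, 0 <= h x)%E ->
  (\int[m]_(x in B) h x = \int[mu]_(x in (B : set X)) h x)%E.
Proof.
move=> mB mh h0.
rewrite -(ge0_integral_pushforward measurable_id_sub mu mB (measurable_funTS mh))//.
Qed.

Section Density.
Variables (g : X -> \bar R) (g_int : mu.-integrable [set: X] g).
Hypothesis g_ge0 : forall x, (0 <= g x)%E.
Local Notation nu := (sub_density AA_sub g_int g_ge0).

Let nu0 : nu set0 = 0%E. Proof. exact: integral_set0. Qed.
Let nu_ge0 B : (0 <= nu B)%E. Proof. by apply: integral_ge0 => x _. Qed.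
Let nu_sigma_additive : semi_sigma_additive nu.
Proof.
move=> F mF tF mUF.
apply: (semi_sigma_additive_nng_induced (measurable_int _ g_int) g_ge0) => //.
- by move=> n; exact: sub_measurable (mF n).
- exact: sub_measurable mUF.
Qed.
HB.instance Definition _ :=
  isMeasure.Build _ _ _ nu nu0 nu_ge0 nu_sigma_additive.

Let nu_fin : fin_num_fun nu.
Proof.
move=> B mB; apply: integrable_fin_num; first exact: sub_measurable mB.
by apply: integrableS g_int => //; exact: sub_measurable mB.
Qed.
HB.instance Definition _ := Measure_isFinite.Build _ _ _ nu nu_fin.

Lemma sub_density_dominates : nu `<< m.
Proof.
apply/null_content_dominatesP => B mB mB0.
apply: null_set_integral => //; first exact: sub_measurable mB.
exact/measurable_funTS/(measurable_int _ g_int).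
Qed.
End Density.

End SubSigmaAlgebra.

(** The same measure, under a name that carries its sigma-finiteness. *)
Definition sub_measure_sf d (X : measurableType d) (R : realType)
    (mu : {measure set X -> \bar R}) (AA : set (set X))
    (AA_sub : is_sub_sigma_algebra AA) (_ : is_sub_sigma_finite mu AA) :=
  sub_measure mu AA_sub.

Section SubMeasureSigmaFinite.
Context d (X : measurableType d) (R : realType).
Variables (mu : {measure set X -> \bar R}) (AA : set (set X)).
Hypotheses (AA_sub : is_sub_sigma_algebra AA) (AA_sf : is_sub_sigma_finite mu AA).
HB.instance Definition _ := Measure.on (sub_measure_sf AA_sub AA_sf).
HB.instance Definition _ :=
  Measure_isSigmaFinite.Build _ _ _ (sub_measure_sf AA_sub AA_sf) AA_sf.
End SubMeasureSigmaFinite.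

Section CondExp.
Local Open Scope ereal_scope.
Context d (X : measurableType d) (R : realType).
Variables (mu : {measure set X -> \bar R}) (AA : set (set X)).
Hypotheses (AA_sub : is_sub_sigma_algebra AA) (AA_sf : is_sub_sigma_finite mu AA).
Local Notation Y := (g_sigma_algebraType AA).
Local Notation mfunA h := (measurable_fun [set: Y] (h : Y -> _)).
Implicit Types (f g h k : X -> \bar R) (B : set X).

Lemma AA_setT : AA [set: X].
Proof. by apply/(sub_measurableE AA_sub); exact: measurableT. Qed.

Lemma AA_preimage d' (Z : measurableType d') (h : X -> Z) (C : set Z) :
  mfunA h -> measurable C -> AA (h @^-1` C).
Proof.
by move=> mh mC; apply/(sub_measurableE AA_sub); rewrite -[X in measurable X]setTI;
  exact: mh.
Qed.

Lemma AA_setI B C : AA B -> AA C -> AA (B `&` C).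
Proof.
move=> /(sub_measurableE AA_sub) mB /(sub_measurableE AA_sub) mC.
by apply/(sub_measurableE AA_sub); exact: measurableI.
Qed.

Lemma sub_sigma_finite_nested : exists F : nat -> set X,
  (forall n, AA (F n) /\ mu (F n) < +oo) /\
  forall x, exists N, forall n, (N <= n)%N -> F n x.
Proof.
have /sigma_finiteP[F [FT ndF mF]] : sigma_finite [set: Y] (sub_measure mu AA_sub).
  exact: AA_sf.
exists F; split=> [n|x].
  by have [/(sub_measurableE AA_sub) ? ?] := mF n.
have : [set: Y] x by [].
rewrite FT => -[N _ FNx]; exists N => n Nn.
by have /subsetPset := ndF _ _ Nn; exact.
Qed.

Lemma is_cond_exp_measurable f h : is_cond_exp mu AA f h ->
  measurable_fun [set: X] h.
Proof. by move=> [mh _ _]; exact: sub_measurable_fun mh. Qed.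

Lemma cond_exp_integrable_exists g : mu.-integrable [set: X] g ->
  (forall x, 0 <= g x) -> exists h, is_cond_exp mu AA g h.
Proof.
move=> ig g0.
have dom : sub_density AA_sub ig g0 `<< sub_measure_sf AA_sub AA_sf.
  exact: sub_density_dominates.
have [h [h0 _ ih hE]] := radon_nikodym_sigma_finite dom.
exists h; split => //; first exact: measurable_int ih.
move=> B /(sub_measurableE AA_sub) mB.
rewrite -(integral_sub_measure mu AA_sub (h := h) mB)//.
  by rewrite -[RHS]hE.
exact: measurable_int ih.
Qed.

Lemma is_cond_exp_nneseries (g h : nat -> X -> \bar R) :
  (forall n, measurable_fun [set: X] (g n)) -> (forall n x, 0 <= g n x) ->
  (forall n, is_cond_exp mu AA (g n) (h n)) ->
  is_cond_exp mu AA (fun x => \sum_(n <oo) g n x) (fun x => \sum_(n <oo) h n x).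
Proof.
move=> mg g0 gh; have h0 n x : 0 <= h n x by have [] := gh n.
split.
- by apply: ge0_emeasurable_sum => // n _; have [] := gh n.
- by move=> x; exact: nneseries_ge0.
move=> B AB; have mB : measurable B by exact: AA_sub.2.
rewrite !integral_nneseries//.
- by apply: eq_eseriesr => n _; have [_ _] := gh n; exact.
- by move=> n; apply/measurable_funTS/(is_cond_exp_measurable (gh n)).
- by move=> n; exact/measurable_funTS/mg.
Qed.

(** f is the sum of its restrictions to countably many disjoint sets of finite
    measure on which it is bounded; each of them has a Radon-Nikodym density,
    and these densities add up to E(f). *)
Lemma cond_expP (f : X -> R) : measurable_fun [set: X] f ->
  (forall x, (0 <= f x)%R) ->
  is_cond_exp mu AA (fun x => (f x)%:E) (cond_exp mu AA (fun x => (f x)%:E)).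
Proof.
move=> mf f0.
suff [h fh] : exists h, is_cond_exp mu AA (fun x => (f x)%:E) h.
  by apply: (xgetPex _ (P := is_cond_exp mu AA _)); exists h.
have [F [mF FT]] := sub_sigma_finite_nested.
pose D n := F n `&` [set x | (f x <= n%:R)%R].
have mD n : measurable (D n).
  apply: measurableI; first by apply: AA_sub.2; exact: (mF n).1.
  by rewrite -[X in measurable X]setTI; exact: measurable_fun_le.
have DT : \bigcup_n (D n) = setT.
  apply/seteqP; split => // x _.
  have [N FN] := FT x; exists (maxn N (Num.truncn (f x)).+1) => //; split.
    by apply: FN; exact: leq_maxl.
  apply: ltW; apply: lt_le_trans (truncnS_gt _) _.
  by rewrite ler_nat leq_maxr.
pose G := seqDU D.
have mG n : measurable (G n).
  by apply: measurableD => //; apply: bigsetU_measurable => k _.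
pose g n x := (f x * \1_(G n) x)%:E.
have mg n : measurable_fun [set: X] (g n).
  by apply/measurable_EFinP/measurable_funM => //; exact: measurable_indic.
have g0 n x : 0 <= g n x by rewrite lee_fin mulr_ge0.
have ig n : mu.-integrable [set: X] (g n).
  apply/integrableP; split => //.
  under eq_integral do rewrite gee0_abs//.
  apply: (@le_lt_trans _ _ (\int[mu]_(x in F n) n%:R%:E)); last first.
    rewrite integral_cst; last by apply: AA_sub.2; exact: (mF n).1.
    by rewrite lte_mul_pinfty// (mF n).2.
  rewrite [leRHS]integral_mkcond; apply: ge0_le_integral => //.
    apply/(measurable_restrictT _ _).1 => //.
    by apply: AA_sub.2; exact: (mF n).1.
  move=> x _; rewrite /g patchE indicE.
  have [xG|xG] := boolP (x \in G n); last first.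
    by rewrite mulr0; case: ifP => //; rewrite lee_fin.
  have [xF /= fn] := subDsetl (set_mem xG).
  by rewrite mem_set// mulr1 lee_fin.
have [h gh] := choice (fun n => cond_exp_integrable_exists (ig n) (g0 n)).
exists (fun x => \sum_(n <oo) h n x).
suff -> : (fun x => (f x)%:E) = fun x => \sum_(n <oo) g n x.
  exact: is_cond_exp_nneseries.
apply/funext => x.
have : setT x by [].
rewrite -DT seqDU_bigcup_eq => -[N _ xN].
rewrite (nneseriesD1 (n := N))//.
rewrite eseries0 ?adde0; last first.
  move=> n _ /andP[_ nN]; rewrite /g indicE memNset ?mulr0// => xn.
  move/trivIsetP : (trivIset_seqDU D) => /(_ n N I I nN).
  by move=> /seteqP[/(_ x)/(_ (conj xn xN))].
by rewrite /g indicE mem_set// mulr1.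
Qed.

(** If h exceeds k with positive measure, then it does so by some 1/(n+1) on a
    set of finite positive measure where k is bounded, which the inequality of
    the integrals over that set excludes. *)
Lemma ae_le_of_integral_le h k : mfunA h -> mfunA k ->
  (forall x, 0 <= h x) -> (forall x, 0 <= k x) ->
  (forall B, AA B -> mu B < +oo ->
     \int[mu]_(x in B) h x <= \int[mu]_(x in B) k x) ->
  {ae mu, forall x, h x <= k x}.
Proof.
move=> mh mk h0 k0 hk.
have [F [mF FT]] := sub_sigma_finite_nested.
pose c n : R := (n.+1%:R^-1)%R.
have c0 n : (0 < c n)%R by rewrite invr_gt0.
pose D n := F n `&` ([set x | k x + (c n)%:E <= h x] `&` [set x | k x <= n%:R%:E]).
have AD n : AA (D n).
  apply: AA_setI; first exact: (mF n).1.
  apply/(sub_measurableE AA_sub); apply: measurableI.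
  - rewrite -[X in measurable X]setTI; apply: measurable_lee => //.
    by apply: emeasurable_funD => //; exact: measurable_cst.
  - rewrite -[X in measurable X]setTI; exact: measurable_lee.
have mD n : measurable (D n) by exact: AA_sub.2.
have mhX := sub_measurable_fun AA_sub mh.
have mkX := sub_measurable_fun AA_sub mk.
have mhD n : measurable_fun (D n) h by exact: (measurable_funTS mhX).
have mkD n : measurable_fun (D n) k by exact: (measurable_funTS mkX).
have Dfin n : mu (D n) < +oo.
  apply: le_lt_trans (mF n).2; apply: le_measure; rewrite ?inE//.
  - by apply: AA_sub.2; exact: (mF n).1.
  - by move=> x [].
have D0 n : mu (D n) = 0.
  have kfin : \int[mu]_(x in D n) k x \is a fin_num.
    rewrite ge0_fin_numE; last by apply: integral_ge0.
    apply: (@le_lt_trans _ _ (\int[mu]_(x in D n) n%:R%:E)).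
      apply: ge0_le_integral => //.
      by move=> x [_ []].
    by rewrite integral_cst// lte_mul_pinfty.
  have : \int[mu]_(x in D n) k x + (c n)%:E * mu (D n) <= \int[mu]_(x in D n) k x.
    apply: le_trans (hk _ (AD n) (Dfin n)).
    rewrite -integral_cst// -ge0_integralD//.
      apply: ge0_le_integral => //.
      - by move=> x _; rewrite adde_ge0// lee_fin ltW.
      - exact: emeasurable_funD.
      - by move=> x [_ []].
    by move=> x _; rewrite lee_fin ltW.
  rewrite -leeBrDl// subee// => cD; apply/eqP; rewrite eq_le measure_ge0 andbT.
  by move: cD; rewrite pmule_rle0// lte_fin.
exists (\bigcup_n D n); split.
- by apply: bigcup_measurable => n _.
- apply/eqP; rewrite eq_le measure_ge0 andbT.
  apply: le_trans (generalized_Boole_inequality _ mD _) _.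
    by apply: bigcup_measurable => n _.
  by rewrite eseries0.
move=> x /= /negP; rewrite -ltNge => kh.
have kfin : k x \is a fin_num by rewrite ge0_fin_numE// (lt_le_trans kh) ?leey.
have [N FN] := FT x.
have [M hM] : exists M, forall n, (M <= n)%N -> k x + (c n)%:E <= h x.
  move: kh kfin; case: (h x) (k x) => [r| |] [s| |]//; last first.
    by exists 0%N => n _; rewrite leey.
  rewrite lte_fin => sr _; exists (Num.truncn (r - s)^-1) => n Mn.
  rewrite -EFinD lee_fin -lerBrDl /c invf_ple ?posrE ?subr_gt0//.
  by apply: ltW; apply: lt_le_trans (truncnS_gt _) _; rewrite ler_nat ltnS.
exists (maxn N (maxn M (Num.truncn (fine (k x))).+1)) => //; split=> [|/=].
  by apply: FN; rewrite leq_maxl.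
split; first by apply: hM; rewrite leq_max leq_maxl orbT.
rewrite -(fineK kfin) lee_fin ltW//; apply: lt_le_trans (truncnS_gt _) _.
by rewrite ler_nat !leq_max leqnn !orbT.
Qed.

Lemma is_cond_exp_le f g h k : measurable_fun [set: X] f ->
  measurable_fun [set: X] g -> (forall x, 0 <= f x) -> (forall x, 0 <= g x) ->
  is_cond_exp mu AA f h -> is_cond_exp mu AA g k ->
  {ae mu, forall x, f x <= g x} -> {ae mu, forall x, h x <= k x}.
Proof.
move=> mf mg f0 g0 [mh h0 hE] [mk k0 kE] fg.
apply: ae_le_of_integral_le => // B AB _; rewrite -hE// -kE//.
apply: ae_ge0_le_integral => //; first exact: AA_sub.2.
- exact: measurable_funTS.
- exact: measurable_funTS.
- by apply: filterS fg => x.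
Qed.

Lemma is_cond_exp_unique f h k : is_cond_exp mu AA f h ->
  is_cond_exp mu AA f k -> {ae mu, forall x, h x = k x}.
Proof.
move=> [mh h0 hE] [mk k0 kE].
have le1 : {ae mu, forall x, h x <= k x}.
  by apply: ae_le_of_integral_le => // B AB _; rewrite -hE// -kE.
have le2 : {ae mu, forall x, k x <= h x}.
  by apply: ae_le_of_integral_le => // B AB _; rewrite -hE// -kE.
by apply: filterS2 le1 le2 => x hk kh; apply/eqP; rewrite eq_le hk kh.
Qed.

Lemma is_cond_expD f g h k : measurable_fun [set: X] f ->
  measurable_fun [set: X] g -> (forall x, 0 <= f x) -> (forall x, 0 <= g x) ->
  is_cond_exp mu AA f h -> is_cond_exp mu AA g k ->
  is_cond_exp mu AA (fun x => f x + g x) (fun x => h x + k x).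
Proof.
move=> mf mg f0 g0 fh gk; have [mh h0 hE] := fh; have [mk k0 kE] := gk; split.
- exact: emeasurable_funD.
- by move=> x; rewrite adde_ge0.
move=> B AB; have mB : measurable B by exact: AA_sub.2.
rewrite !ge0_integralD//; first by rewrite hE// kE.
- exact/measurable_funTS/(is_cond_exp_measurable fh).
- exact/measurable_funTS/(is_cond_exp_measurable gk).
- exact: measurable_funTS.
- exact: measurable_funTS.
Qed.

Import HBNNSimple.

(** The equality of the integrals over the sets of AA extends to AA-measurable
    weights, through simple functions and monotone convergence. *)
Lemma integral_pull_out f h (a : X -> \bar R) : measurable_fun [set: X] f ->
  (forall x, 0 <= f x) -> is_cond_exp mu AA f h ->
  mfunA a -> (forall x, 0 <= a x) -> forall B, AA B ->
  \int[mu]_(x in B) (a x * f x) = \int[mu]_(x in B) (a x * h x).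
Proof.
move=> mf f0 fh ma a0 B AB; have [_ h0 hE] := fh.
have mh := is_cond_exp_measurable fh.
have mB : measurable B by exact: AA_sub.2.
pose s : {nnsfun Y >-> R}^nat := nnsfun_approx measurableT ma.
have ms n : measurable_fun [set: X] (s n : X -> R).
  by apply: (sub_measurable_fun AA_sub); exact: measurable_funP.
have s0 n x : (0 <= s n x)%R by [].
have key g : measurable_fun [set: X] g -> (forall x, 0 <= g x) ->
    \int[mu]_(x in B) (a x * g x) =
    limn (fun n => \sum_(r \in range (s n))
      r%:E * \int[mu]_(x in B `&` (s n @^-1` [set r])) g x).
  move=> mg g0.
  have mrB n r : measurable (s n @^-1` [set r] : set X).
    by rewrite -[X in measurable X]setTI; exact: ms.
  transitivity (\int[mu]_(x in B) limn (fun n => (s n x)%:E * g x)).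
    apply: eq_integral => x _; apply/esym/cvg_lim => //.
    have sa : (fun n => (s n x)%:E) @ \oo --> a x by exact: cvg_nnsfun_approx.
    have [gfin|ginf] := boolP (g x \is a fin_num); first exact: cvgeZr.
    have [ax0|ax0] := eqVneq (a x) 0; last first.
      by apply: cvgeM => //; [exact: mule_def_neq0_infty|exact: cvg_cst].
    rewrite ax0 mul0e (_ : (fun n => _) = cst 0); first exact: cvg_cst.
    apply/funext => n; suff -> : s n x = 0%R by rewrite mul0e.
    have : (s n x)%:E <= a x by rewrite /s nnsfun_approxE; exact: le_approx.
    by rewrite ax0 lee_fin => sx; apply/eqP; rewrite eq_le sx s0.
  rewrite monotone_convergence//; last 3 first.
  - move=> n; apply: emeasurable_funM; last exact: measurable_funTS.
    by apply/measurable_EFinP/measurable_funTS.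
  - by move=> n x _; rewrite mule_ge0// lee_fin.
  - move=> x _ m n mn; rewrite lee_wpmul2r// lee_fin.
    by have /lefP := nd_nnsfun_approx measurableT ma mn; exact.
  congr (limn _); apply/funext => n.
  transitivity (\int[mu]_(x in B)
      (\sum_(r \in range (s n)) (r * \1_(s n @^-1` [set r]) x)%:E * g x)).
    apply: eq_integral => x _.
    rewrite [in LHS](fimfunE (s n)) -fsumEFin// ge0_mule_fsuml//.
    by move=> r; rewrite nnfun_muleindic_ge0.
  rewrite ge0_integral_fsum//; last 2 first.
  - move=> r; apply: emeasurable_funM; last exact: measurable_funTS.
    apply/measurable_EFinP/measurable_funM => //.
  - by move=> r x _; rewrite mule_ge0// nnfun_muleindic_ge0.
  apply: eq_fsbigr => r /set_mem[y _ sy].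
  have r0 : (0 <= r)%R by rewrite -sy.
  rewrite integral_mkcondr -ge0_integralZl_EFin//.
  - apply: eq_integral => x _; rewrite patchE indicE.
    by case: (x \in _); rewrite ?mulr1// mulr0 mul0e mule0.
  - by move=> x _; rewrite patchE; case: ifP.
  - by apply/measurable_funTS/(measurable_restrictT _ _).1 => //; exact: measurable_funTS.
rewrite (key _ mf f0) (key _ mh h0); congr (limn _); apply/funext => n.
apply: eq_fsbigr => r _; rewrite hE//; apply: AA_setI => //.
exact: (AA_preimage (measurable_funP (s n)) (measurable_set1 r)).
Qed.

Lemma is_cond_expM f h (a : X -> \bar R) : measurable_fun [set: X] f ->
  (forall x, 0 <= f x) -> is_cond_exp mu AA f h ->
  mfunA a -> (forall x, 0 <= a x) ->
  is_cond_exp mu AA (fun x => a x * f x) (fun x => a x * h x).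
Proof.
move=> mf f0 fh ma a0; have [mh h0 _] := fh; split.
- exact: emeasurable_funM.
- by move=> x; rewrite mule_ge0.
- exact: integral_pull_out.
Qed.

End CondExp.
(** * Conditional expectation of real and complex functions *)

Section SignedCondExp.
Context d (X : measurableType d) (R : realType).
Variables (mu : {measure set X -> \bar R}) (AA : set (set X)).
Hypotheses (AA_sub : is_sub_sigma_algebra AA) (AA_sf : is_sub_sigma_finite mu AA).
Local Notation Y := (g_sigma_algebraType AA).
Local Notation mfunA h := (measurable_fun [set: Y] (h : Y -> _)).
Local Notation E f := (cond_exp mu AA (fun x => (f x)%:E)).
Implicit Types (f g h a : X -> R).

Lemma cond_exp_measurable f : measurable_fun [set: X] f ->
  (forall x, 0 <= f x) -> mfunA (E f).
Proof. by move=> mf f0; have [] := cond_expP AA_sub AA_sf mf f0. Qed.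

Lemma measurable_funA d' (Z : measurableType d') (h : X -> Z) :
  mfunA h -> measurable_fun [set: X] h.
Proof. exact: sub_measurable_fun. Qed.

Lemma measurable_cond_exp f : measurable_fun [set: X] f ->
  (forall x, 0 <= f x) -> measurable_fun [set: X] (E f).
Proof. by move=> mf f0; apply: measurable_funA; exact: cond_exp_measurable. Qed.

Lemma cond_exp_ge0 f x : measurable_fun [set: X] f ->
  (forall x, 0 <= f x) -> (0 <= E f x)%E.
Proof. by move=> mf f0; have [_ ->] := cond_expP AA_sub AA_sf mf f0. Qed.

Lemma fin_num_cond_exp f x : measurable_fun [set: X] f ->
  (forall x, 0 <= f x) -> (E f x < +oo)%E -> E f x \is a fin_num.
Proof. by move=> mf f0; rewrite ge0_fin_numE// cond_exp_ge0. Qed.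

Lemma integral_cond_exp f B : measurable_fun [set: X] f ->
  (forall x, 0 <= f x) -> AA B ->
  (\int[mu]_(x in B) (f x)%:E = \int[mu]_(x in B) E f x)%E.
Proof. by move=> mf f0; have [_ _] := cond_expP AA_sub AA_sf mf f0; exact. Qed.

Lemma cond_expD f g : measurable_fun [set: X] f -> measurable_fun [set: X] g ->
  (forall x, 0 <= f x) -> (forall x, 0 <= g x) ->
  {ae mu, forall x, E (fun x => f x + g x) x = (E f x + E g x)%E}.
Proof.
move=> mf mg f0 g0.
apply: (is_cond_exp_unique AA_sub AA_sf (f := fun x => (f x + g x)%:E)).
  apply: cond_expP => //; first exact: measurable_funD.
  by move=> x; rewrite addr_ge0.
apply: (is_cond_expD AA_sub (f := EFin \o f) (g := EFin \o g)).
- exact/measurable_EFinP.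
- exact/measurable_EFinP.
- by move=> x; rewrite lee_fin.
- by move=> x; rewrite lee_fin.
- exact: cond_expP.
- exact: cond_expP.
Qed.

Lemma cond_expM a f : mfunA a -> (forall x, 0 <= a x) ->
  measurable_fun [set: X] f -> (forall x, 0 <= f x) ->
  {ae mu, forall x, E (fun x => a x * f x) x = ((a x)%:E * E f x)%E}.
Proof.
move=> ma a0 mf f0.
apply: (is_cond_exp_unique AA_sub AA_sf (f := fun x => (a x * f x)%:E)).
  apply: cond_expP => //; last by move=> x; rewrite mulr_ge0.
  by apply: measurable_funM => //; exact: measurable_funA.
apply: (is_cond_expM AA_sub (f := EFin \o f) (a := EFin \o a)).
- exact/measurable_EFinP.
- by move=> x; rewrite lee_fin.
- exact: cond_expP.
- exact/measurable_EFinP.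
- by move=> x; rewrite lee_fin.
Qed.

Lemma cond_exp_ae_le f g : measurable_fun [set: X] f ->
  measurable_fun [set: X] g -> (forall x, 0 <= f x) -> (forall x, 0 <= g x) ->
  {ae mu, forall x, f x <= g x} -> {ae mu, forall x, (E f x <= E g x)%E}.
Proof.
move=> mf mg f0 g0 fg.
apply: (is_cond_exp_le AA_sub AA_sf (f := EFin \o f) (g := EFin \o g)).
- exact/measurable_EFinP.
- exact/measurable_EFinP.
- by move=> x; rewrite lee_fin.
- by move=> x; rewrite lee_fin.
- exact: cond_expP.
- exact: cond_expP.
- by apply: filterS fg => x; rewrite lee_fin.
Qed.

Lemma cond_exp_le f g : measurable_fun [set: X] f ->
  measurable_fun [set: X] g -> (forall x, 0 <= f x) -> (forall x, f x <= g x) ->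
  {ae mu, forall x, (E f x <= E g x)%E}.
Proof.
move=> mf mg f0 fg; apply: cond_exp_ae_le => //; last exact: aeW.
by move=> x; exact: le_trans (fg x).
Qed.

Lemma cond_exp_ae_eq f g : measurable_fun [set: X] f ->
  measurable_fun [set: X] g -> (forall x, 0 <= f x) -> (forall x, 0 <= g x) ->
  {ae mu, forall x, f x = g x} -> {ae mu, forall x, E f x = E g x}.
Proof.
move=> mf mg f0 g0 fg.
have L1 : {ae mu, forall x, (E f x <= E g x)%E}.
  by apply: cond_exp_ae_le => //; apply: filterS fg => x ->.
have L2 : {ae mu, forall x, (E g x <= E f x)%E}.
  by apply: cond_exp_ae_le => //; apply: filterS fg => x ->.
by apply: filterS2 L1 L2 => x fg1 gf1; apply/eqP; rewrite eq_le fg1 gf1.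
Qed.

Lemma cond_exp_lty f : measurable_fun [set: X] f -> (forall x, 0 <= f x) ->
  (\int[mu]_x (f x)%:E < +oo)%E -> {ae mu, forall x, (E f x < +oo)%E}.
Proof.
move=> mf f0 fi.
have iE : mu.-integrable [set: X] (E f).
  apply/integrableP; split.
    exact: measurable_cond_exp.
  under eq_integral do rewrite gee0_abs ?cond_exp_ge0//.
  by rewrite -integral_cond_exp//; exact: AA_setT.
apply: filterS (integrable_ae measurableT iE) => x /(_ Logic.I).
by rewrite ge0_fin_numE// cond_exp_ge0.
Qed.

(** f has integral 0 over the AA-measurable set where E f = 0,
    so it vanishes almost everywhere there. *)
Lemma cond_exp_eq0 f g : measurable_fun [set: X] f ->
  measurable_fun [set: X] g -> (forall x, 0 <= f x) -> (forall x, 0 <= g x) ->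
  (forall x, f x = 0 -> g x = 0) ->
  {ae mu, forall x, E f x = 0%E -> E g x = 0%E}.
Proof.
move=> mf mg f0 g0 fg; pose Z := E f @^-1` [set 0%E].
have AZ : AA Z.
  by apply: (AA_preimage AA_sub) => //; exact: cond_exp_measurable.
have mZ : measurable Z by exact: AA_sub.2.
have mE h : measurable_fun [set: X] h -> (forall x, 0 <= h x) ->
    measurable_fun Z (E h).
  move=> mh h0; apply: measurable_funTS.
  exact: measurable_cond_exp.
have fZ : {ae mu, forall x, Z x -> f x = 0}.
  have /(ae_eq_integral_abs mu mZ _).1 : (\int[mu]_(x in Z) `|(f x)%:E| = 0)%E.
    under eq_integral do rewrite gee0_abs ?lee_fin//.
    rewrite integral_cond_exp//.
    by rewrite (eq_integral (cst 0%E)) ?integral0// => x /set_mem.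
  move=> H; apply: filterS (H _) => [x /= Hx Zx|].
    by have [] := Hx Zx.
  exact/measurable_EFinP/measurable_funTS.
have /(ae_eq_integral_abs mu mZ _).1 H : (\int[mu]_(x in Z) `|E g x| = 0)%E.
  under eq_integral do rewrite gee0_abs ?cond_exp_ge0//.
  rewrite -integral_cond_exp//.
  rewrite (ae_eq_integral (cst 0%E)) ?integral0//.
  - exact/measurable_EFinP/measurable_funTS.
  - by apply: filterS fZ => x fx Zx; rewrite fg ?fx.
by apply: filterS (H (mE _ mg g0)) => x Hx Ex; exact: Hx.
Qed.

(** The real counterpart of [dom_cond_exp]. *)
Definition rdom g := measurable_fun [set: X] g /\
  {ae mu, forall x, (E (fun x => `|g x|) x < +oo)%E}.

Lemma rdom_le f g : measurable_fun [set: X] f -> measurable_fun [set: X] g ->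
  (forall x, `|f x| <= g x) -> {ae mu, forall x, (E g x < +oo)%E} -> rdom f.
Proof.
move=> mf mg fg gfin; split => //.
have := cond_exp_le (measurableT_comp (@normr_measurable R _) mf) mg
  (fun x => normr_ge0 _) fg.
by apply: filterS2 gfin => x /[swap]; exact: le_lt_trans.
Qed.

Lemma measurable_abs g : measurable_fun [set: X] g ->
  measurable_fun [set: X] (fun x => `|g x|).
Proof. by move=> mg; exact: measurableT_comp. Qed.

Lemma rdom_parts g : rdom g -> {ae mu, forall x,
  (E (g^\+)%R x < +oo)%E /\ (E (g^\-)%R x < +oo)%E}.
Proof.
move=> [mg gfin].
have le_p := cond_exp_le (measurable_funrpos mg) (measurable_abs mg)
  (funrpos_ge0 g).
have le_n := cond_exp_le (measurable_funrneg mg) (measurable_abs mg)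
  (funrneg_ge0 g).
have {}le_p := le_p _; have {}le_n := le_n _.
apply: filterS3 gfin (le_p _) (le_n _).
- by move=> x g1 g2 g3; split; [exact: le_lt_trans g2 g1|exact: le_lt_trans g3 g1].
- by move=> x; rewrite /funrpos ge_max ler_norm normr_ge0.
- by move=> x; rewrite /funrneg ge_max -normrN ler_norm normr_ge0.
Qed.

Lemma rcond_expE g x : rcond_exp mu AA g x =
  fine (E (g^\+)%R x) - fine (E (g^\-)%R x).
Proof. by []. Qed.

Lemma rcond_exp_measurable g : measurable_fun [set: X] g ->
  mfunA (rcond_exp mu AA g).
Proof.
move=> mg; apply: measurable_funB.
- apply: (measurableT_comp (@fine_measurable R _ measurableT)).
  by apply: cond_exp_measurable; [exact: measurable_funrpos|exact: funrpos_ge0].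
- apply: (measurableT_comp (@fine_measurable R _ measurableT)).
  by apply: cond_exp_measurable; [exact: measurable_funrneg|exact: funrneg_ge0].
Qed.

(** E(f - g) does not depend on how a function is written as a difference of
    nonnegative ones, hence the linearity of E. *)
Lemma rcond_expB f g : measurable_fun [set: X] f -> measurable_fun [set: X] g ->
  (forall x, 0 <= f x) -> (forall x, 0 <= g x) ->
  {ae mu, forall x, (E f x < +oo)%E} -> {ae mu, forall x, (E g x < +oo)%E} ->
  {ae mu, forall x, rcond_exp mu AA (fun x => f x - g x) x =
    fine (E f x) - fine (E g x)}.
Proof.
move=> mf mg f0 g0 ff gf; set k := fun x => f x - g x.
have mk : measurable_fun [set: X] k by exact: measurable_funB.
have mp := measurable_funrpos mk; have mn := measurable_funrneg mk.
have p0 := funrpos_ge0 k; have n0 := funrneg_ge0 k.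
have le_p : {ae mu, forall x, (E (k^\+)%R x <= E f x)%E}.
  apply: cond_exp_le => // x; rewrite /funrpos ge_max f0 andbT /k.
  by rewrite lerBlDr lerDl.
have le_n : {ae mu, forall x, (E (k^\-)%R x <= E g x)%E}.
  apply: cond_exp_le => // x; rewrite /funrneg ge_max g0 andbT /k opprB.
  by rewrite lerBlDr lerDl.
have D1 := cond_expD mf mn f0 n0; have D2 := cond_expD mg mp g0 p0.
have DE : (fun x => (f x + (k^\-)%R x)%:E) = (fun x => (g x + (k^\+)%R x)%:E).
  apply/funext => x; congr (_%:E); rewrite /funrpos /funrneg /k opprB.
  have [h|/ltW h] := leP (f x) (g x).
    by rewrite max_l ?subr_ge0// max_r ?subr_le0//; ring.
  by rewrite max_r ?subr_le0// max_l ?subr_ge0//; ring.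
rewrite DE in D1.
apply: filterS (filterI (filterI D1 D2) (filterI (filterI ff gf) (filterI le_p le_n))).
move=> x [[e1 e2] [[f1 g1] [lp ln]]].
have p1 := le_lt_trans lp f1; have n1 := le_lt_trans ln g1.
have {e1 e2} : (E f x + E (k^\-)%R x = E g x + E (k^\+)%R x)%E by rewrite -e1.
rewrite rcond_expE; move: f1 g1 p1 n1.
have := cond_exp_ge0 x mf f0; have := cond_exp_ge0 x mg g0.
have := cond_exp_ge0 x mp p0; have := cond_exp_ge0 x mn n0.
move: (E f x) (E g x) (E (k^\+)%R x) (E (k^\-)%R x).
move=> [a| |] [b| |] [p| |] [q| |]//= _ _ _ _ _ _ _ _ [e].
by lra.
Qed.

Lemma rcond_expD f g : rdom f -> rdom g ->
  {ae mu, forall x, rcond_exp mu AA (fun x => f x + g x) x =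
    rcond_exp mu AA f x + rcond_exp mu AA g x}.
Proof.
move=> fd gd; have [mf _] := fd; have [mg _] := gd.
have mfp := measurable_funrpos mf; have mfn := measurable_funrneg mf.
have mgp := measurable_funrpos mg; have mgn := measurable_funrneg mg.
have fp0 := funrpos_ge0 f; have fn0 := funrneg_ge0 f.
have gp0 := funrpos_ge0 g; have gn0 := funrneg_ge0 g.
have Dp := cond_expD mfp mgp fp0 gp0; have Dn := cond_expD mfn mgn fn0 gn0.
have ff := rdom_parts fd; have gf := rdom_parts gd.
have pfin : {ae mu, forall x, (E (fun x => (f^\+)%R x + (g^\+)%R x) x < +oo)%E}.
  by apply: filterS3 Dp ff gf => x -> [? _] [? _]; rewrite lte_add_pinfty.
have nfin : {ae mu, forall x, (E (fun x => (f^\-)%R x + (g^\-)%R x) x < +oo)%E}.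
  by apply: filterS3 Dn ff gf => x -> [_ ?] [_ ?]; rewrite lte_add_pinfty.
have BE := rcond_expB (measurable_funD mfp mgp) (measurable_funD mfn mgn)
  (fun x => addr_ge0 (fp0 x) (gp0 x)) (fun x => addr_ge0 (fn0 x) (gn0 x)) pfin nfin.
have -> : (fun x => f x + g x) = (fun x => ((f^\+)%R x + (g^\+)%R x) -
                                     ((f^\-)%R x + (g^\-)%R x)).
  apply/funext => x; rewrite -[in LHS](funrpos_sub f) -[in LHS](funrpos_sub g).
  by ring.
apply: filterS (filterI (filterI BE (filterI Dp Dn)) (filterI ff gf)) => x.
move=> [[-> [-> ->]] [[f1 f2] [g1 g2]]].
rewrite (fineD (fin_num_cond_exp mfp fp0 f1) (fin_num_cond_exp mgp gp0 g1)).
rewrite (fineD (fin_num_cond_exp mfn fn0 f2) (fin_num_cond_exp mgn gn0 g2)).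
by rewrite opprD addrACA.
Qed.

Lemma rdomD f g : rdom f -> rdom g -> rdom (fun x => f x + g x).
Proof.
move=> [mf ff] [mg gf].
apply: (rdom_le _ (measurable_funD (measurable_abs mf) (measurable_abs mg))).
- exact: measurable_funD.
- by move=> x; exact: ler_normD.
have := cond_expD (measurable_abs mf) (measurable_abs mg)
  (fun x => normr_ge0 _) (fun x => normr_ge0 _).
by apply: filterS3 ff gf => x f1 g1 ->; rewrite lte_add_pinfty.
Qed.

Lemma rdomM a f : mfunA a -> rdom f -> rdom (fun x => a x * f x).
Proof.
move=> ma [mf ff]; split; first exact: measurable_funM (measurable_funA ma) mf.
under [fun x => (`|_|)%:E]eq_fun do rewrite normrM.
have := cond_expM (a := fun x => `|a x|) (measurableT_comp (@normr_measurable R _) ma)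
  (fun x => normr_ge0 _) (measurable_abs mf) (fun x => normr_ge0 _).
by apply: filterS2 ff => x f1 ->; rewrite lte_mul_pinfty.
Qed.

Lemma rcond_expN f x : rcond_exp mu AA (fun y => - f y) x = - rcond_exp mu AA f x.
Proof.
rewrite /rcond_exp opprB; congr (_ - fine (cond_exp mu AA _ x)).
by apply/funext => y; rewrite opprK.
Qed.

Let rcond_expM_ge0 a f : mfunA a -> (forall x, 0 <= a x) -> rdom f ->
  {ae mu, forall x, rcond_exp mu AA (fun x => a x * f x) x =
    a x * rcond_exp mu AA f x}.
Proof.
move=> ma a0 fd; have [mf _] := fd; have ff := rdom_parts fd.
have mfp := measurable_funrpos mf; have mfn := measurable_funrneg mf.
have fp0 := funrpos_ge0 f; have fn0 := funrneg_ge0 f.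
have M1 := cond_expM ma a0 mfp fp0; have M2 := cond_expM ma a0 mfn fn0.
have maX := measurable_funA ma.
have fin1 : {ae mu, forall x, (E (fun x => a x * (f^\+)%R x) x < +oo)%E}.
  by apply: filterS2 M1 ff => x -> [? _]; rewrite lte_mul_pinfty// lee_fin.
have fin2 : {ae mu, forall x, (E (fun x => a x * (f^\-)%R x) x < +oo)%E}.
  by apply: filterS2 M2 ff => x -> [_ ?]; rewrite lte_mul_pinfty// lee_fin.
have := rcond_expB (measurable_funM maX mfp) (measurable_funM maX mfn)
  (fun x => mulr_ge0 (a0 x) (fp0 x)) (fun x => mulr_ge0 (a0 x) (fn0 x)) fin1 fin2.
have -> : (fun x => a x * f x) =
    (fun x => a x * (f^\+)%R x - a x * (f^\-)%R x).
  by apply/funext => x; rewrite -mulrBr funrpos_sub.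
move=> BE; apply: filterS (filterI BE (filterI (filterI M1 M2) ff)) => x.
move=> [-> [[-> ->] [f1 f2]]].
rewrite rcond_expE mulrBr !fineM ?fin_num_cond_exp//.

Qed.

Lemma rcond_expM a f : mfunA a -> rdom f ->
  {ae mu, forall x, rcond_exp mu AA (fun x => a x * f x) x =
    a x * rcond_exp mu AA f x}.
Proof.
move=> ma fd; have Map := measurable_funrpos ma; have Man := measurable_funrneg ma.
have P := rcond_expM_ge0 Map (funrpos_ge0 a) fd.
have N := rcond_expM_ge0 Man (funrneg_ge0 a) fd.
have nd : rdom (fun x => - ((a^\-)%R x * f x)).
  under eq_fun do rewrite -mulNr.
  by apply: rdomM => //; exact: measurableT_comp Man.
have := rcond_expD (rdomM Map fd) nd.
have -> : (fun x => a x * f x) =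
    (fun x => (a^\+)%R x * f x + - ((a^\-)%R x * f x)).
  by apply/funext => x; rewrite -mulrBl funrpos_sub.
apply: filterS3 P N => x Px Nx ->.
by rewrite rcond_expN Px Nx -mulrBl funrpos_sub.
Qed.

(** E(f^+) and E(f^-) agree, hence f^+ and f^- have the same integral. *)
Lemma Rintegral_rcond_exp0 f : mu.-integrable [set: X] (EFin \o f) ->
  {ae mu, forall x, rcond_exp mu AA f x = 0} -> \int[mu]_x f x = 0.
Proof.
move=> fi f0; have mf : measurable_fun [set: X] f.
  by apply/measurable_EFinP; exact: measurable_int fi.
have mfp := measurable_funrpos mf; have mfn := measurable_funrneg mf.
have fp0 := funrpos_ge0 f; have fn0 := funrneg_ge0 f.
have ip : (\int[mu]_x ((f^\+)%R x)%:E < +oo)%E.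
  by rewrite integrable_lty//; exact: integrable_funrpos.
have in_ : (\int[mu]_x ((f^\-)%R x)%:E < +oo)%E.
  by rewrite integrable_lty//; exact: integrable_funrneg.
have eE : {ae mu, forall x, E (f^\+)%R x = E (f^\-)%R x}.
  apply: filterS3 f0 (cond_exp_lty mfp fp0 ip) (cond_exp_lty mfn fn0 in_) => x.
  rewrite rcond_expE => /eqP; rewrite subr_eq0 => /eqP e p n.
  by rewrite -[LHS]fineK ?e ?fineK// ge0_fin_numE ?cond_exp_ge0.
rewrite /Rintegral integralE.
rewrite funerpos funerneg /=.
rewrite !integral_cond_exp//; [|exact: AA_setT|exact: AA_setT].
rewrite (ae_eq_integral (E (f^\-)%R))//.
- rewrite subee// -integral_cond_exp//; last exact: AA_setT.
  by rewrite ge0_fin_numE// integral_ge0// => x _; rewrite lee_fin.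
- exact: measurable_cond_exp.
- exact: measurable_cond_exp.
- by apply: filterS eE.
Qed.

Section Complex.
Implicit Types (u v c : X -> R[i]).

Definition cmeasurableA c := mfunA (fun x => complex.Re (c x)) /\
  mfunA (fun x => complex.Im (c x)).

Lemma dom_cond_expP u : dom_cond_exp mu AA u <->
  rdom (fun x => complex.Re (u x)) /\ rdom (fun x => complex.Im (u x)).
Proof.
split=> [[mu' uf]|[[mr rf] [mi if_]]].
  split; apply: rdom_le uf; try by [exact: mu'.1|exact: mu'.2|exact: measurable_cmod].
  - by move=> x; exact: Re_le_cmod.
  - by move=> x; exact: Im_le_cmod.
split; first by split.
have D := cond_expD (measurable_abs mr) (measurable_abs mi)
  (fun x => normr_ge0 _) (fun x => normr_ge0 _).
have := cond_exp_le (measurable_cmod (conj mr mi))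
  (measurable_funD (measurable_abs mr) (measurable_abs mi))
  (fun x => cmod_ge0 _) (fun x => cmod_le _).
move=> L; apply: filterS (filterI (filterI L D) (filterI rf if_)) => x.
move=> [[l e] [r i]]; apply: le_lt_trans l _; rewrite e.
by rewrite lte_add_pinfty.
Qed.

Lemma ccond_exp_measurable u : cmeasurable u -> cmeasurableA (ccond_exp mu AA u).
Proof. by move=> [mr mi]; split; exact: rcond_exp_measurable. Qed.

Lemma dom_cond_expM c u : cmeasurableA c -> dom_cond_exp mu AA u ->
  dom_cond_exp mu AA (fun x => c x * u x).
Proof.
move=> [cr ci] /dom_cond_expP[ur ui]; apply/dom_cond_expP; split.
- under eq_fun do rewrite Re_mul.
  by apply: rdomD; apply: rdomM => //; exact: measurableT_comp ci.
- under eq_fun do rewrite Im_mul.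
  by apply: rdomD; apply: rdomM.
Qed.

Lemma ccond_expM c u : cmeasurableA c -> dom_cond_exp mu AA u ->
  {ae mu, forall x, ccond_exp mu AA (fun x => c x * u x) x =
    c x * ccond_exp mu AA u x}.
Proof.
move=> [cr ci] /dom_cond_expP[ur ui].
have cin : mfunA (fun x => - complex.Im (c x)) by exact: measurableT_comp ci.
have D1 := rcond_expD (rdomM cr ur) (rdomM cin ui).
have D2 := rcond_expD (rdomM cr ui) (rdomM ci ur).
have M1 := rcond_expM cr ur; have M2 := rcond_expM cin ui.
have M3 := rcond_expM cr ui; have M4 := rcond_expM ci ur.
apply: filterS (filterI (filterI D1 D2) (filterI (filterI M1 M2) (filterI M3 M4))).
move=> x [[d1 d2] [[m1 m2] [m3 m4]]].
rewrite {1}/ccond_exp.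
under [X in rcond_exp _ _ X _ +i* _]eq_fun do rewrite Re_mul.
under [X in _ +i* rcond_exp _ _ X _]eq_fun do rewrite Im_mul.
rewrite d1 d2 m1 m2 m3 m4 /ccond_exp; case: (c x) => a b /=.
by apply/eqP; rewrite eq_complex/= mulNr !eqxx.
Qed.

Lemma dom_cond_expD u v : dom_cond_exp mu AA u -> dom_cond_exp mu AA v ->
  dom_cond_exp mu AA (fun x => u x + v x).
Proof.
move=> /dom_cond_expP[ur ui] /dom_cond_expP[vr vi]; apply/dom_cond_expP.
have rE x : complex.Re (u x + v x) = complex.Re (u x) + complex.Re (v x).
  by case: (u x) (v x) => ? ? [? ?].
have iE x : complex.Im (u x + v x) = complex.Im (u x) + complex.Im (v x).
  by case: (u x) (v x) => ? ? [? ?].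
by split; [under eq_fun do rewrite rE|under eq_fun do rewrite iE]; exact: rdomD.
Qed.

Lemma ccond_expD u v : dom_cond_exp mu AA u -> dom_cond_exp mu AA v ->
  {ae mu, forall x, ccond_exp mu AA (fun x => u x + v x) x =
    ccond_exp mu AA u x + ccond_exp mu AA v x}.
Proof.
move=> /dom_cond_expP[ur ui] /dom_cond_expP[vr vi].
have rE x : complex.Re (u x + v x) = complex.Re (u x) + complex.Re (v x).
  by case: (u x) (v x) => ? ? [? ?].
have iE x : complex.Im (u x + v x) = complex.Im (u x) + complex.Im (v x).
  by case: (u x) (v x) => ? ? [? ?].
apply: filterS2 (rcond_expD ur vr) (rcond_expD ui vi) => x D1 D2.
rewrite {1}/ccond_exp.
under [X in rcond_exp _ _ X _ +i* _]eq_fun do rewrite rE.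
under [X in _ +i* rcond_exp _ _ X _]eq_fun do rewrite iE.
by rewrite D1 D2.
Qed.

Lemma dom_cond_exp_real f : measurable_fun [set: X] f -> (forall x, 0 <= f x) ->
  {ae mu, forall x, (E f x < +oo)%E} -> dom_cond_exp mu AA (fun x => (f x)%:C).
Proof.
move=> mf f0 ff; split; first by split => //; exact: measurable_cst.
have e : (fun y => (cmod (f y)%:C)%:E) = (fun y => (f y)%:E).
  by apply/funext => y; rewrite /= expr0n addr0 sqrtr_sqr ger0_norm.
by apply: filterS ff => x; rewrite e.
Qed.

Lemma ccond_exp_real f : measurable_fun [set: X] f -> (forall x, 0 <= f x) ->
  {ae mu, forall x, ccond_exp mu AA (fun x => (f x)%:C) x = (fine (E f x))%:C}.
Proof.
move=> mf f0.
have z : {ae mu, forall x, E (fun=> 0) x = 0%E}.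
  have c0 : mfunA (fun _ : X => 0 : R) by exact: measurable_cst.
  have := cond_expM c0 (fun=> lexx 0) mf f0.
  have e : (fun x => (0 * f x)%:E) = (fun=> 0%:E).
    by apply/funext => x; rewrite mul0r.
  by apply: filterS => x; rewrite mul0e e.
apply: filterS z => x z.
have e1 : (fun y => (Num.max (f y) 0)%:E) = (fun y => (f y)%:E).
  by apply/funext => y; rewrite (max_idPl (f0 y)).
have e2 : (fun y => (Num.max (- f y) 0)%:E) = (fun=> 0%:E).
  by apply/funext => y; rewrite max_r ?oppr_le0.
have e3 : (fun _ : X => (Num.max (- 0 : R) 0)%:E) = (fun=> 0%:E).
  by apply/funext => y; rewrite oppr0 maxxx.
have e4 : (fun _ : X => (Num.max (0 : R) 0)%:E) = (fun=> 0%:E).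
  by apply/funext => y; rewrite maxxx.
by rewrite /ccond_exp /rcond_exp /= e1 e2 e3 e4 z !subr0.
Qed.

Lemma ccond_exp_eq0 u : dom_cond_exp mu AA u -> {ae mu, forall x,
  E (fun x => cmod (u x)) x = 0%E -> ccond_exp mu AA u x = 0}.
Proof.
move=> [mu' _]; have mc := measurable_cmod mu'.
have key g : measurable_fun [set: X] g -> (forall x, `|g x| <= cmod (u x)) ->
    {ae mu, forall x, E (fun x => cmod (u x)) x = 0%E -> rcond_exp mu AA g x = 0}.
  move=> mg gu.
  have Lp : {ae mu, forall x, (E (g^\+)%R x <= E (fun x => cmod (u x)) x)%E}.
    apply: cond_exp_le => //; first exact: measurable_funrpos.
    move=> x; rewrite /funrpos ge_max cmod_ge0 andbT.
    by apply: le_trans (gu x); exact: ler_norm.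
  have Ln : {ae mu, forall x, (E (g^\-)%R x <= E (fun x => cmod (u x)) x)%E}.
    apply: cond_exp_le => //; first exact: measurable_funrneg.
    move=> x; rewrite /funrneg ge_max cmod_ge0 andbT.
    by apply: le_trans (gu x); rewrite -normrN; exact: ler_norm.
  apply: filterS2 Lp Ln => x + + x0; rewrite x0 rcond_expE => p n.
  have -> : E (g^\+)%R x = 0%E.
    by apply/eqP; rewrite eq_le p cond_exp_ge0//; exact: measurable_funrpos.
  have -> : E (g^\-)%R x = 0%E.
    by apply/eqP; rewrite eq_le n cond_exp_ge0//; exact: measurable_funrneg.
  exact: subrr.
have K1 := key _ mu'.1 (fun x => Re_le_cmod (u x)).
have K2 := key _ mu'.2 (fun x => Im_le_cmod (u x)).
by apply: filterS2 K1 K2 => x k1 k2 x0; rewrite /ccond_exp k1// k2.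
Qed.

End Complex.
End SignedCondExp.
(** * The operator on L2 *)

Section Operator.
Context d (X : measurableType d) (R : realType).
Variables (mu : {measure set X -> \bar R}) (AA : set (set X)).
Hypotheses (AA_sub : is_sub_sigma_algebra AA) (AA_sf : is_sub_sigma_finite mu AA).
Local Notation Y := (g_sigma_algebraType AA).
Local Notation mfunA h := (measurable_fun [set: Y] (h : Y -> _)).
Local Notation E f := (cond_exp mu AA (fun x => (f x)%:E)).
Implicit Types (u v w s : X -> R[i]) (A : set X).

Lemma cmeasurableA_cmeasurable s : cmeasurableA AA s -> cmeasurable s.
Proof. by move=> [sr si]; split; exact: (measurable_funA AA_sub). Qed.

Lemma measurable_indicA A : AA A -> mfunA (\1_A : X -> R).
Proof. by move=> /(sub_measurableE AA_sub) mA; exact: measurable_indic. Qed.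

Lemma cond_exp_bounded (f : X -> R) (k : R) : measurable_fun [set: X] f ->
  (forall x, 0 <= f x) -> (forall x, f x <= k) ->
  {ae mu, forall x, (E f x <= k%:E)%E}.
Proof.
move=> mf f0 fk; apply: (is_cond_exp_le AA_sub AA_sf (f := EFin \o f) (g := cst k%:E)).
- exact/measurable_EFinP.
- exact: measurable_cst.
- by move=> x; rewrite lee_fin.
- by move=> x; rewrite lee_fin (le_trans (f0 x)).
- exact: cond_expP.
- split => //.
  by move=> x; rewrite lee_fin (le_trans (f0 x)).
- by apply: aeW => x; rewrite lee_fin.
Qed.

Lemma op_bound_integral T (K : R) f : op_bound mu T K -> L2 mu f -> L2 mu (T f) ->
  (\int[mu]_x ((cmod (T f x)) ^+ 2)%:E <=
   (K ^+ 2)%:E * \int[mu]_x ((cmod (f x)) ^+ 2)%:E)%E.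
Proof.
move=> [K0 TK] Lf LTf.
have int0 g : (0 <= \int[mu]_x ((cmod (g x)) ^+ 2)%:E)%E.
  by apply: integral_ge0 => x _; rewrite lee_fin sqr_ge0.
have intE g : L2 mu g ->
    (\int[mu]_x ((cmod (g x)) ^+ 2)%:E = (L2norm mu g ^+ 2)%:E)%E.
  move=> [mg gfin]; rewrite /L2norm sqr_sqrtr; last first.
    by apply: Rintegral_ge0 => x _; rewrite sqr_ge0.
  by rewrite /Rintegral fineK// ge0_fin_numE.
rewrite !intE// -EFinM lee_fin -exprMn.
by rewrite ler_pXn2r ?nnegrE ?mulr_ge0 ?L2norm_ge0// TK.
Qed.

(** An AA-measurable weight, supported on a set of finite measure on which both
    it and E(|v|^2) are bounded, brings v into L2. *)
Lemma L2_local s v A (M n : R) : cmeasurable s -> cmeasurable v -> AA A ->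
  (mu A < +oo)%E -> (forall x, A x -> cmod (s x) ^+ 2 <= M) ->
  (forall x, ~ A x -> s x = 0) ->
  (forall x, A x -> (E (fun x => cmod (v x) ^+ 2) x <= n%:E)%E) ->
  L2 mu (fun x => s x * v x).
Proof.
move=> ms mv AA_A muA sM s0 vn.
have mA : measurable A by exact: AA_sub.2.
have [[x0 Ax0]|A0] := pselect (exists x, A x); last first.
  have -> : (fun x => s x * v x) = (fun=> 0); last exact: L2_0.
  by apply/funext => x; rewrite s0 ?mul0r// => Ax; apply: A0; exists x.
have M0 : 0 <= M by apply: le_trans (sM _ Ax0); rewrite sqr_ge0.
have msv := cmeasurable_mul ms mv; split => //.
have mv2 := measurable_cmod_sq mv.
have n0 : 0 <= n.
  by rewrite -lee_fin (le_trans _ (vn _ Ax0))// cond_exp_ge0// => x; exact: sqr_ge0.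
apply: (@le_lt_trans _ _ (\int[mu]_(x in A) (M%:E * (cmod (v x) ^+ 2)%:E))%E).
  rewrite [leRHS]integral_mkcond; apply: ge0_le_integral => //.
  - by move=> x _; rewrite lee_fin sqr_ge0.
  - by apply/measurable_EFinP; exact: measurable_cmod_sq.
  - apply/(measurable_restrictT _ _).1 => //; apply: measurable_funeM.
    by apply/measurable_EFinP/measurable_funTS.
  - move=> x _; rewrite patchE cmod_sqM; case: ifPn => [/set_mem Ax|/negP xA].
      by rewrite -EFinM lee_fin ler_wpM2r ?sqr_ge0// sM.
    rewrite s0; last by move=> Ax; apply: xA; exact/mem_set.
    by rewrite cmod_sq /= expr0n addr0 mul0r.
rewrite ge0_integralZl_EFin//; last 2 first.
- by move=> x _; rewrite lee_fin sqr_ge0.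
- by apply/measurable_EFinP/measurable_funTS.
rewrite lte_mul_pinfty//.
rewrite (integral_cond_exp AA_sub AA_sf mv2 (fun x => sqr_ge0 _))//.
apply: (@le_lt_trans _ _ (\int[mu]_(x in A) n%:E)%E).
  apply: ge0_le_integral => //.
  - by move=> x _; apply: cond_exp_ge0 => // y; exact: sqr_ge0.
  - by apply: measurable_funTS; apply: measurable_cond_exp => // y; exact: sqr_ge0.
by rewrite integral_cst// lte_mul_pinfty.
Qed.

Section Kernel.
Variables u w : X -> R[i].
Hypotheses (mu_u : cmeasurable u) (mu_w : cmeasurable w).
Local Notation T := (MwEMu mu AA w u).
Local Notation a := (E (fun x => cmod (u x) ^+ 2)).
Local Notation c := (E (fun x => cmod (w x) ^+ 2)).
Local Notation e := (ccond_exp mu AA (fun x => u x * w x)).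

Let mu2 := measurable_cmod_sq mu_u.
Let mw2 := measurable_cmod_sq mu_w.
Let u2_ge0 x : 0 <= cmod (u x) ^+ 2. Proof. exact: sqr_ge0. Qed.
Let w2_ge0 x : 0 <= cmod (w x) ^+ 2. Proof. exact: sqr_ge0. Qed.
Let a_ge0 x : (0 <= a x)%E. Proof. exact: cond_exp_ge0. Qed.
Let c_ge0 x : (0 <= c x)%E. Proof. exact: cond_exp_ge0. Qed.
Let ma : mfunA a. Proof. exact: cond_exp_measurable. Qed.
Let mc : mfunA c. Proof. exact: cond_exp_measurable. Qed.

Lemma MwEMu_real f (g : X -> R) : measurable_fun [set: X] g ->
  (forall x, 0 <= g x) -> (forall x, u x * f x = (g x)%:C) ->
  {ae mu, forall x, T f x = w x * (fine (E g x))%:C}.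
Proof.
move=> mg g0 ufg; rewrite /MwEMu.
have -> : (fun x => u x * f x) = (fun x => (g x)%:C) by exact/funext.
by apply: filterS (ccond_exp_real AA_sub AA_sf mg g0) => x ->.
Qed.

(* \bar u 1_B need not be in L2 as long as E(|u|^2) may be infinite, so u is
   truncated to the set where |u| <= n *)
Let t (n : nat) : X -> R := \1_[set x | cmod (u x) <= n%:R].
Let v n x : R := t n x * cmod (u x) ^+ 2.

Let mt n : measurable_fun [set: X] (t n).
Proof.
apply: measurable_indic; rewrite -[X in measurable X]setTI.
apply: measurable_fun_le => //; exact: measurable_cmod.
Qed.

Let mv n : measurable_fun [set: X] (v n).
Proof. exact: measurable_funM. Qed.

Let v_ge0 n x : 0 <= v n x.
Proof. by rewrite mulr_ge0. Qed.

Let v_le n x : v n x <= n%:R ^+ 2.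
Proof.
rewrite /v /t indicE; have [xn|_] := boolP (x \in _); last first.
  by rewrite mul0r sqr_ge0.
rewrite mul1r ler_pXn2r ?nnegrE ?cmod_ge0//; exact: set_mem xn.
Qed.

(** For f = \bar u 1_B 1_{|u| <= n} with B in AA, one has T f = w 1_B E(v n): the
    norm bound integrates over B the inequality E(v n)^2 E(|w|^2) <= K^2 E(v n). *)
Lemma truncated_bound (K : R) n : (forall f, L2 mu f -> L2 mu (T f)) ->
  op_bound mu T K ->
  {ae mu, forall x, (c x * E (v n) x <= (K ^+ 2)%:E)%E}.
Proof.
move=> TL2 TK; set b := E (v n).
have b_le : {ae mu, forall x, (b x <= (n%:R ^+ 2)%:E)%E}.
  exact: cond_exp_bounded (mv n) (v_ge0 n) (v_le n).
have mb : mfunA b by exact: cond_exp_measurable.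
have b0 x : (0 <= b x)%E by exact: cond_exp_ge0.
have mfb : mfunA (fun x => fine (b x)).
  exact: (measurableT_comp (@fine_measurable R _ measurableT)).
have key : {ae mu, forall x,
    ((fine (b x) ^+ 2)%:E * c x <= (K ^+ 2)%:E * b x)%E}.
  apply: (ae_le_of_integral_le AA_sub AA_sf).
  - apply: emeasurable_funM => //; apply/measurable_EFinP.
    exact: measurable_funX.
  - exact: measurable_funeM.
  - by move=> x; rewrite mule_ge0// lee_fin sqr_ge0.
  - by move=> x; rewrite mule_ge0// lee_fin sqr_ge0.
  move=> B AB muB; have mB : measurable B by exact: AA_sub.2.
  pose f x := (\1_B x * t n x)%:C * (u x)^*.
  have fsq x : cmod (f x) ^+ 2 = \1_B x * v n x.
    rewrite cmod_sqM cmod_sq_real cmod_sq_conj exprMn indic_sq /t indic_sq.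
    by rewrite -mulrA.
  have mBv : measurable_fun [set: X] (fun x => \1_B x * v n x).
    by apply: measurable_funM => //; exact: measurable_indic.
  have Bv0 x : 0 <= \1_B x * v n x by rewrite mulr_ge0.
  have intB (g : X -> R) : (\int[mu]_x (\1_B x * g x)%:E = \int[mu]_(x in B) (g x)%:E)%E.
    rewrite [RHS]integral_mkcond; apply: eq_integral => x _.
    by rewrite patchE indicE; case: ifP => _; rewrite ?mul1r ?mul0r.
  have fL2 : L2 mu f.
    split.
      apply: cmeasurable_mul; last exact: cmeasurable_conj.
      by apply/cmeasurable_real/measurable_funM => //; exact: measurable_indic.
    under eq_integral do rewrite fsq; rewrite intB.
    apply: (@le_lt_trans _ _ (\int[mu]_(x in B) (n%:R ^+ 2)%:E)%E).
      apply: ge0_le_integral => //.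
      - by move=> x _; rewrite lee_fin.
      - exact/measurable_EFinP/measurable_funTS.
      - by move=> x _; rewrite lee_fin.
    by rewrite integral_cst// lte_mul_pinfty// lee_fin sqr_ge0.
  have uf x : u x * f x = (\1_B x * v n x)%:C.
    by rewrite /f mulrCA mul_conj /v mulrA [RHS]rmorphM.
  have Tf := MwEMu_real mBv Bv0 uf.
  have EB := cond_expM AA_sub AA_sf (measurable_indicA AB)
    (fun x => ler0n _ _) (mv n) (v_ge0 n).
  have Tf2 : {ae mu, forall x, cmod (T f x) ^+ 2 =
      \1_B x * (fine (b x) ^+ 2 * cmod (w x) ^+ 2)}.
    apply: filterS3 Tf EB b_le => x -> -> bx.
    have bfin : b x \is a fin_num by rewrite ge0_fin_numE// (le_lt_trans bx) ?ltry.
    rewrite fineM// cmod_sqM cmod_sq_real exprMn /= indic_sq.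
    by rewrite mulrC -mulrA.
  have LTf := TL2 _ fL2.
  have lhsE : (\int[mu]_x ((cmod (T f x)) ^+ 2)%:E =
      \int[mu]_(x in B) ((fine (b x) ^+ 2)%:E * c x))%E.
    transitivity (\int[mu]_x
        (\1_B x * (fine (b x) ^+ 2 * cmod (w x) ^+ 2))%:E)%E.
      move: LTf Tf2; set g := MwEMu _ _ _ _ _ => -[mg _] Tf2.
      apply: ae_eq_integral => //.
      - exact/measurable_EFinP/measurable_cmod_sq.
      - apply/measurable_EFinP/measurable_funM; first exact: measurable_indic.
        apply: measurable_funM => //; apply: measurable_funX.
        exact: (measurable_funA AA_sub mfb).
      - by apply: filterS Tf2 => x Tx _; rewrite Tx.
    rewrite intB; under eq_integral do rewrite EFinM.
    apply: (integral_pull_out AA_sub (f := fun x => (cmod (w x) ^+ 2)%:E)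
      (a := fun x => (fine (b x) ^+ 2)%:E)) => //.
    - exact/measurable_EFinP.
    - exact: cond_expP.
    - by apply/measurable_EFinP; exact: measurable_funX.
    - by move=> x; rewrite lee_fin sqr_ge0.
  have rhsE : (\int[mu]_x ((cmod (f x)) ^+ 2)%:E = \int[mu]_(x in B) b x)%E.
    by under eq_integral do rewrite fsq; rewrite intB; exact: integral_cond_exp.
  have := op_bound_integral TK fL2 LTf; rewrite lhsE rhsE => /le_trans; apply.
  rewrite ge0_integralZl_EFin//; last exact: sqr_ge0.
  exact: measurable_funTS (measurable_funA AA_sub mb).
apply: filterS2 key b_le => x; move: (b0 x) (c_ge0 x).
move: (b x) (c x) => [r| |]//= [s| |]//=.
- rewrite -!EFinM !lee_fin => r0 s0 h _.
  have [->|rn] := eqVneq r 0; first by rewrite mulr0 sqr_ge0.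
  have rp : 0 < r by rewrite lt_neqAle eq_sym rn.
  by rewrite -(ler_pM2r rp); lra.
- rewrite lee_fin => r0 _ h _; have [->|rn] := eqVneq r 0.
    by rewrite mule0 lee_fin sqr_ge0.
  have rp : 0 < r by rewrite lt_neqAle eq_sym rn.
  by move: h; rewrite gt0_muley ?lte_fin ?exprn_gt0// -EFinM leye_eq.
Qed.

(** Monotone convergence in [truncated_bound], as n grows. *)
Lemma cond_exp_product_bound (K : R) : (forall f, L2 mu f -> L2 mu (T f)) ->
  op_bound mu T K -> {ae mu, forall x, (c x * a x <= (K ^+ 2)%:E)%E}.
Proof.
move=> TL2 TK; apply: (ae_le_of_integral_le AA_sub AA_sf).
- exact: emeasurable_funM.
- exact: measurable_cst.
- by move=> x; rewrite mule_ge0.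
- by move=> x; rewrite lee_fin sqr_ge0.
move=> B AB _; have mB : measurable B by exact: AA_sub.2.
have mcB : measurable_fun B c by exact: measurable_funTS (measurable_funA AA_sub mc).
have mEv n : mfunA (E (v n)) by exact: cond_exp_measurable.
rewrite -(integral_pull_out AA_sub (f := fun x => (cmod (u x) ^+ 2)%:E)
  (a := c))//; [|exact/measurable_EFinP|exact: cond_expP].
have vlim x : limn (fun n => (c x * (v n x)%:E)%E) = (c x * (cmod (u x) ^+ 2)%:E)%E.
  apply/cvg_lim => //; apply: cvg_near_cst.
  near=> n; congr (c x * _%:E)%E; rewrite /v /t indicE mem_set ?mul1r//=.
  apply: ltW; apply: lt_le_trans (truncnS_gt _) _; rewrite ler_nat.
  by near: n; exists (Num.truncn (cmod (u x))).+1.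
have mcv n : measurable_fun B (fun x => c x * (v n x)%:E)%E.
  by apply: emeasurable_funM => //; exact/measurable_EFinP/measurable_funTS.
have cv0 n x : (0 <= c x * (v n x)%:E)%E by rewrite mule_ge0// lee_fin.
have cvnd x : {homo (fun n => (c x * (v n x)%:E)%E) : m n / (m <= n)%N >-> (m <= n)%E}.
  move=> m n mn; rewrite lee_wpmul2l// lee_fin /v ler_wpM2r//.
  rewrite /t !indicE; have [xm|_] := boolP (x \in _); last by rewrite ler0n.
  by rewrite mem_set//=; apply: le_trans (set_mem xm) _; rewrite ler_nat.
under eq_integral do rewrite -vlim.
rewrite monotone_convergence//.
apply: lime_le.
  apply: ereal_nondecreasing_is_cvgn => m n mn.
  by apply: ge0_le_integral => // x _; exact: cvnd.
near=> n.
have -> : (\int[mu]_(x in B) (c x * (v n x)%:E) =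
           \int[mu]_(x in B) (c x * E (v n) x))%E.
  apply: (integral_pull_out AA_sub (f := fun x => (v n x)%:E)) => //.
  - exact/measurable_EFinP.
  - by move=> x; rewrite lee_fin.
  - exact: cond_expP.
apply: ae_ge0_le_integral => //.
- by move=> x _; rewrite mule_ge0// cond_exp_ge0.
- apply: emeasurable_funM => //.
  exact: measurable_funTS (measurable_funA AA_sub (mEv n)).
- by move=> x _; rewrite lee_fin sqr_ge0.
- by apply: filterS (truncated_bound n TL2 TK).
Unshelve. all: by end_near. Qed.

Section Local.
Variable A : set X.
Hypotheses (AA_A : AA A) (A_fin : (mu A < +oo)%E).
Variable n : R.
Hypotheses (aA : forall x, A x -> (a x <= n%:E)%E)
  (cA : forall x, A x -> (c x <= n%:E)%E)
  (eA : forall x, A x -> cmod (e x) ^+ 2 <= n).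
Hypothesis uw_dom : dom_cond_exp mu AA (fun x => u x * w x).

Let s1 x : R[i] := (\1_A x * fine (a x))%:C.
Let s2 x : R[i] := (\1_A x)%:C * e x.
Let h x : R := \1_A x * cmod (u x) ^+ 2.
(* f is orthogonal to \bar u on every fiber, and T g is s1 w *)
Let f x : R[i] := s1 x * w x - s2 x * (u x)^*.
Let g x : R[i] := (\1_A x)%:C * (u x)^*.

Let mfa : mfunA (fun x => fine (a x)).
Proof. exact: (measurableT_comp (@fine_measurable R _ measurableT)). Qed.

Let m1A : mfunA (\1_A : X -> R).
Proof. exact: measurable_indicA. Qed.

Let ms1 : cmeasurableA AA s1.
Proof.
split; last exact: measurable_cst.
exact: (measurable_funM m1A mfa).
Qed.

Let me : cmeasurableA AA e.
Proof. by apply: ccond_exp_measurable => //; exact: cmeasurable_mul. Qed.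

Let ms2 : cmeasurableA AA s2.
Proof.
have [mer mei] := me; split.
- have -> : (fun x => complex.Re (s2 x)) = (fun x => \1_A x * complex.Re (e x)).
    by apply/funext => x; rewrite /s2; case: (e x) => p q /=; rewrite mul0r subr0.
  exact: (measurable_funM m1A mer).
- have -> : (fun x => complex.Im (s2 x)) = (fun x => \1_A x * complex.Im (e x)).
    by apply/funext => x; rewrite /s2; case: (e x) => p q /=; rewrite mul0r addr0.
  exact: (measurable_funM m1A mei).
Qed.

Let notA_1 x : ~ A x -> \1_A x = 0 :> R.
Proof. by move=> Ax; rewrite indicE memNset. Qed.

Let A_1 x : A x -> \1_A x = 1 :> R.
Proof. by move=> Ax; rewrite indicE mem_set. Qed.

Let fine_le x : A x -> 0 <= fine (a x) <= n.
Proof.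
move=> Ax; rewrite fine_ge0//= -lee_fin fineK ?aA//.
by rewrite ge0_fin_numE// (le_lt_trans (aA Ax)) ?ltry.
Qed.

Let u_conj2 : (fun x => (cmod (u x)^* ^+ 2)%:E) = (fun x => (cmod (u x) ^+ 2)%:E).
Proof. by apply/funext => x; rewrite cmod_sq_conj. Qed.

Let Lf1 : L2 mu (fun x => s1 x * w x).
Proof.
apply: (L2_local (A := A) (M := n ^+ 2) (n := n)) => //.
- exact: cmeasurableA_cmeasurable.
- move=> x Ax; rewrite /s1 cmod_sq_real A_1// mul1r.
  by have /andP[a0 an] := fine_le Ax; rewrite ler_pXn2r ?nnegrE// (le_trans a0).
- by move=> x Ax; rewrite /s1 notA_1// mul0r.
Qed.

Let Lf2 : L2 mu (fun x => s2 x * (u x)^*).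
Proof.
apply: (L2_local (A := A) (M := n) (n := n)) => //.
- exact: cmeasurableA_cmeasurable.
- exact: cmeasurable_conj.
- by move=> x Ax; rewrite /s2 A_1// mul1r; exact: eA.
- by move=> x Ax; rewrite /s2 notA_1// mul0r.
- by rewrite u_conj2.
Qed.

Let Lf : L2 mu f.
Proof. exact: L2_sub. Qed.

Let Lg : L2 mu g.
Proof.
apply: (L2_local (A := A) (M := 1) (n := n)) => //.
- by apply: cmeasurable_real; exact: (measurable_funA AA_sub m1A).
- exact: cmeasurable_conj.
- by move=> x Ax; rewrite A_1// cmod_sq_real expr1n.
- by move=> x Ax; rewrite notA_1.
- by rewrite u_conj2.
Qed.

Let mh : measurable_fun [set: X] h.
Proof. by apply: measurable_funM => //; exact: (measurable_funA AA_sub m1A). Qed.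

Let h_ge0 x : 0 <= h x.
Proof. by rewrite mulr_ge0. Qed.

Let Eh : {ae mu, forall x, E h x = (\1_A x * fine (a x))%:E}.
Proof.
have := cond_expM AA_sub AA_sf m1A (fun x => ler0n _ _) mu2 u2_ge0.
apply: filterS => x ->; have [Ax|Ax] := pselect (A x); last first.
  by rewrite notA_1// mul0e mul0r.
rewrite A_1// mul1e mul1r fineK// ge0_fin_numE//.
by rewrite (le_lt_trans (aA Ax)) ?ltry.
Qed.

Let Tg : {ae mu, forall x, T g x = s1 x * w x}.
Proof.
have ug x : u x * g x = (h x)%:C by rewrite /g mulrCA mul_conj [RHS]rmorphM.
apply: filterS2 (MwEMu_real mh h_ge0 ug) Eh => x -> ->.
by rewrite mulrC.
Qed.

Let uf_eq : (fun x => u x * f x) =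
  (fun x => s1 x * (u x * w x) + (- s2 x) * (h x)%:C).
Proof.
apply/funext => x; rewrite /f mulrBr mulrCA mulNr; congr (_ - _).
rewrite mulrCA mul_conj /h; have [Ax|Ax] := pselect (A x).
  by rewrite A_1// mul1r.
by rewrite /s2 notA_1// !mul0r.
Qed.

Let ms2N : cmeasurableA AA (fun x => - s2 x).
Proof.
have [r i] := ms2; split.
- have -> : (fun x => complex.Re (- s2 x)) = (fun x => - complex.Re (s2 x)).
    by apply/funext => x; case: (s2 x).
  exact: measurableT_comp.
- have -> : (fun x => complex.Im (- s2 x)) = (fun x => - complex.Im (s2 x)).
    by apply/funext => x; case: (s2 x).
  exact: measurableT_comp.
Qed.

Let h_dom : dom_cond_exp mu AA (fun x => (h x)%:C).
Proof.
apply: dom_cond_exp_real => //.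
by apply: filterS Eh => x ->; rewrite ltry.
Qed.

Let uf_dom : dom_cond_exp mu AA (fun x => u x * f x).
Proof.
rewrite uf_eq; exact: (dom_cond_expD AA_sub AA_sf
  (dom_cond_expM AA_sub AA_sf ms1 uw_dom) (dom_cond_expM AA_sub AA_sf ms2N h_dom)).
Qed.

Let Euf : {ae mu, forall x, ccond_exp mu AA (fun x => u x * f x) x = 0}.
Proof.
rewrite uf_eq.
have D := ccond_expD AA_sub AA_sf (dom_cond_expM AA_sub AA_sf ms1 uw_dom)
  (dom_cond_expM AA_sub AA_sf ms2N h_dom).
have M1 := ccond_expM AA_sub AA_sf ms1 uw_dom.
have M2 := ccond_expM AA_sub AA_sf ms2N h_dom.
have M3 := ccond_exp_real AA_sub AA_sf mh h_ge0.
apply: filterS (filterI (filterI D Eh) (filterI M1 (filterI M2 M3))) => x.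
move=> [[-> Ehx] [-> [-> ->]]]; rewrite Ehx /s1 /s2 /=.
have [Ax|Ax] := pselect (A x); last by rewrite notA_1// !mul0r oppr0 mul0r addr0.
by rewrite A_1// !mul1r mulNr [X in _ - X]mulrC subrr.
Qed.

(** As T f = 0, f is orthogonal to the range of T, in particular to s1 w = T g.
    It is also orthogonal to s2 \bar u, because E(u f) = 0. Hence it is
    orthogonal to itself. *)
Lemma orthogonal_fiber :
  (forall f g, L2 mu f -> L2 mu g -> T f = (fun=> 0) %[ae mu] ->
     rip mu (T g) f = 0) ->
  (forall f, L2 mu f -> L2 mu (T f)) ->
  {ae mu, forall x, s1 x * w x = s2 x * (u x)^*}.
Proof.
move=> Tker TL2.
have Tf : T f = (fun=> 0) %[ae mu].
  by apply: filterS Euf => x Ex _; rewrite /MwEMu Ex mulr0.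
have f1f : rip mu (fun x => s1 x * w x) f = 0.
  rewrite -(rip_ae (TL2 _ Lg) Lf1 Lf); first exact: Tker.
  by apply: filterS Tg => x Tgx _.
have f2f : rip mu (fun x => s2 x * (u x)^*) f = 0.
  pose s2c x := (s2 x)^*.
  have ms2c : cmeasurableA AA s2c.
    have [r i] := ms2; split.
    - have -> : (fun x => complex.Re (s2c x)) = (fun x => complex.Re (s2 x)).
        by apply/funext => x; rewrite /s2c; case: (s2 x).
      exact: r.
    - have -> : (fun x => complex.Im (s2c x)) = (fun x => - complex.Im (s2 x)).
        by apply/funext => x; rewrite /s2c; case: (s2 x).
      exact: measurableT_comp.
  have E0 : {ae mu, forall x,
      ccond_exp mu AA (fun x => s2c x * (u x * f x)) x = 0}.
    apply: filterS2 (ccond_expM AA_sub AA_sf ms2c uf_dom) Euf => x -> ->.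
    by rewrite mulr0.
  have FE : (fun x => complex.Re (s2 x * (u x)^*) * complex.Re (f x) +
        complex.Im (s2 x * (u x)^*) * complex.Im (f x)) =
      (fun x => complex.Re (s2c x * (u x * f x))).
    apply/funext => x; rewrite /s2c; case: (s2 x) (u x) (f x) => p q [r t'] [y z].
    by rewrite /=; ring.
  rewrite /rip FE; apply: (Rintegral_rcond_exp0 AA_sub AA_sf).
    by rewrite -FE; exact: integrable_rip.
  by apply: filterS E0 => x /(congr1 (@complex.Re R)).
have ff : rip mu f f = 0 by rewrite {1}/f ripBl// f1f f2f subr0.
have f0 : (\int[mu]_x `|(cmod (f x) ^+ 2)%:E| = 0)%E.
  have [mf ffin] := Lf.
  under eq_integral do rewrite gee0_abs ?lee_fin ?sqr_ge0//.
  have i0 : (0 <= \int[mu]_x (cmod (f x) ^+ 2)%:E)%E.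
    by apply: integral_ge0 => x _; rewrite lee_fin sqr_ge0.
  rewrite -[LHS]fineK ?ge0_fin_numE//; congr (_%:E).
  by rewrite -[RHS]ff; apply: eq_Rintegral => x _; rewrite cmod_sq !expr2.
have [mf _] := Lf.
have /(ae_eq_integral_abs mu measurableT _).1 H := f0.
have mf2 : measurable_fun [set: X] (fun x => (cmod (f x) ^+ 2)%:E).
  exact/measurable_EFinP/measurable_cmod_sq.
apply: filterS (H mf2) => x /(_ Logic.I) /= [] /eqP.
rewrite sqrf_eq0 => /eqP /ComplexField.Normc.eq0_normc /eqP.
by rewrite /f subr_eq0 => /eqP.
Qed.

(** Apply E(|.|^2) to E(|u|^2) w = E(u w) \bar u. *)
Lemma local_equality :
  (forall f g, L2 mu f -> L2 mu g -> T f = (fun=> 0) %[ae mu] ->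
     rip mu (T g) f = 0) ->
  (forall f, L2 mu f -> L2 mu (T f)) ->
  {ae mu, forall x, A x ->
    ((fine (a x) ^+ 2)%:E * c x = (cmod (e x) ^+ 2)%:E * a x)%E}.
Proof.
move=> Tker TL2; have [mer mei] := me.
pose p x : R := \1_A x * fine (a x) ^+ 2; pose q x : R := \1_A x * cmod (e x) ^+ 2.
have mp : mfunA p by apply: (measurable_funM m1A); exact: measurable_funX.
have mq : mfunA q.
  apply: (measurable_funM m1A).
  under eq_fun do rewrite cmod_sq.
  exact: (measurable_funD (measurable_funX 2 mer) (measurable_funX 2 mei)).
have p0 x : 0 <= p x by rewrite mulr_ge0 ?sqr_ge0.
have q0 x : 0 <= q x by rewrite mulr_ge0 ?sqr_ge0.
have pq : {ae mu, forall x, p x * cmod (w x) ^+ 2 = q x * cmod (u x) ^+ 2}.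
  apply: filterS (orthogonal_fiber Tker TL2) => x.
  move=> /(congr1 (fun z : R[i] => cmod z ^+ 2)).
  by rewrite !cmod_sqM cmod_sq_conj !cmod_sq_real !exprMn !indic_sq.
have mpX := measurable_funA AA_sub mp; have mqX := measurable_funA AA_sub mq.
have EQ := cond_exp_ae_eq AA_sub AA_sf (measurable_funM mpX mw2)
  (measurable_funM mqX mu2) (fun x => mulr_ge0 (p0 x) (w2_ge0 x))
  (fun x => mulr_ge0 (q0 x) (u2_ge0 x)) pq.
have M1 := cond_expM AA_sub AA_sf mp p0 mw2 w2_ge0.
have M2 := cond_expM AA_sub AA_sf mq q0 mu2 u2_ge0.
apply: filterS3 EQ M1 M2 => x + + + Ax.
by rewrite /p /q A_1// !mul1r => -> -> ->.
Qed.

End Local.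
End Kernel.
End Operator.
(** * The equality case *)

Theorem corollary2p7 (d : measure_display) (X : measurableType d)
  (R : realType) (mu : {sigma_finite_measure set X -> \bar R})
  (mu_complete : measure_is_complete mu)
  (AA : set (set X))
  (AA_sub : is_sub_sigma_algebra AA)
  (AA_sigma_finite : is_sub_sigma_finite mu AA)
  (u w : X -> R[i])
  (u_dom : dom_cond_exp mu AA u)
  (w_dom : dom_cond_exp mu AA w)
  (uf_dom : forall f : X -> R[i], L2 mu f ->
     dom_cond_exp mu AA (fun x => u x * f x))
  (T_bounded : bounded_operator mu (MwEMu mu AA w u))
  (p : R) (p_gt0 : 0 < p)
  (T_hypo : p_hyponormal mu p (MwEMu mu AA w u))
  (supp_Eu : mu.-negligible (~` supp (ccond_exp mu AA u))) :
  dom_cond_exp mu AA (fun x => u x * w x) /\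
  {ae mu, forall x,
    ((cmod (ccond_exp mu AA (fun y => u y * w y) x)) ^+ 2)%:E =
    (cond_exp mu AA (fun y => ((cmod (u y)) ^+ 2)%:E) x *
     cond_exp mu AA (fun y => ((cmod (w y)) ^+ 2)%:E) x)%E}.
Proof.
have [TL2 _ _ [K TK]] := T_bounded.
have mu_u := u_dom.1; have mu_w := w_dom.1.
have mu2 := measurable_cmod_sq mu_u; have mw2 := measurable_cmod_sq mu_w.
have u2_ge0 x : 0 <= cmod (u x) ^+ 2 by exact: sqr_ge0.
have w2_ge0 x : 0 <= cmod (w x) ^+ 2 by exact: sqr_ge0.
set a := cond_exp mu AA (fun y => ((cmod (u y)) ^+ 2)%:E).
set c := cond_exp mu AA (fun y => ((cmod (w y)) ^+ 2)%:E).
pose m := cond_exp mu AA (fun y => (cmod (u y * w y))%:E).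
have a0 x : (0 <= a x)%E by exact: cond_exp_ge0.
have c0 x : (0 <= c x)%E by exact: cond_exp_ge0.
have ca : {ae mu, forall x, (c x * a x <= (K ^+ 2)%:E)%E}.
  exact: (cond_exp_product_bound AA_sub AA_sigma_finite mu_u mu_w TL2 TK).
(* where neither factor vanishes, their bounded product forces both to be finite *)
have fin_ca (y z : \bar R) : (0 <= y)%E -> (0 <= z)%E ->
    (z * y <= (K ^+ 2)%:E)%E -> y != 0%E -> z != 0%E ->
    (y < +oo)%E /\ (z < +oo)%E.
  move=> y0 z0; case: y z y0 z0 => [y| |]//= [z| |]//= y0 z0.
  - by rewrite !ltry.
  - by move=> + yn _; rewrite gt0_mulye ?lt0e ?yn ?y0// leye_eq.
  - by move=> + _ zn; rewrite gt0_muley ?lt0e ?zn ?z0// leye_eq.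
have muw := cmeasurable_mul mu_u mu_w; have mm := measurable_cmod muw.
have m_a : {ae mu, forall x, a x = 0%E -> m x = 0%E}.
  apply: (cond_exp_eq0 AA_sub AA_sigma_finite mu2 mm u2_ge0 (fun x => cmod_ge0 _)) => x.
  move=> /eqP; rewrite sqrf_eq0 => /eqP /ComplexField.Normc.eq0_normc ->.
  by rewrite mul0r ComplexField.Normc.normc0.
have m_c : {ae mu, forall x, c x = 0%E -> m x = 0%E}.
  apply: (cond_exp_eq0 AA_sub AA_sigma_finite mw2 mm w2_ge0 (fun x => cmod_ge0 _)) => x.
  move=> /eqP; rewrite sqrf_eq0 => /eqP /ComplexField.Normc.eq0_normc ->.
  by rewrite mulr0 ComplexField.Normc.normc0.
have uw_dom : dom_cond_exp mu AA (fun x => u x * w x).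
  split => //.
  have le_m : {ae mu, forall x, (m x <=
      cond_exp mu AA (fun y => (cmod (u y) ^+ 2 + cmod (w y) ^+ 2)%:E) x)%E}.
    apply: cond_exp_le => //; first exact: measurable_funD.
      by move=> x; exact: cmod_ge0.
    move=> x; rewrite ComplexField.Normc.normcM.
    by have := sqr_ge0 (cmod (u x) - cmod (w x)); have := u2_ge0 x;
      have := w2_ge0 x; rewrite sqrrB; lra.
  have D := cond_expD AA_sub AA_sigma_finite mu2 mw2 u2_ge0 w2_ge0.
  apply: filterS (filterI (filterI le_m D) (filterI ca (filterI m_a m_c))) => x.
  move=> [[ml De] [cax [ma mc]]]; rewrite -/m.
  have [/ma ->|an] := eqVneq (a x) 0%E; first by rewrite ltry.
  have [/mc ->|cn] := eqVneq (c x) 0%E; first by rewrite ltry.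
  have [ay cy] := fin_ca _ _ (a0 x) (c0 x) cax an cn.
  by apply: le_lt_trans ml _; rewrite De lte_add_pinfty.
split => //; set e := ccond_exp mu AA (fun y => u y * w y).
have [F [mF FT]] := sub_sigma_finite_nested AA_sub AA_sigma_finite.
(* the bounds that make the test functions of the local equality square integrable *)
pose A n := F n `&` ([set x | (a x <= n%:R%:E)%E] `&` ([set x | (c x <= n%:R%:E)%E]
  `&` [set x | cmod (e x) ^+ 2 <= n%:R])).
have [mer mei] : cmeasurableA AA e by exact: ccond_exp_measurable.
have AA_le (h : X -> \bar R) (n : nat) :
    measurable_fun [set: g_sigma_algebraType AA]
      (h : g_sigma_algebraType AA -> \bar R) ->
    AA [set x | (h x <= n%:R%:E)%E].
  move=> mh; have := AA_preimage AA_sub mh (emeasurable_itv `]-oo, n%:R%:E]).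
  by congr AA; apply/seteqP; split => x /=; rewrite in_itv.
have AA_n n : AA (A n).
  apply: AA_setI => //; first exact: (mF n).1.
  apply: AA_setI => //; first by apply: AA_le; exact: cond_exp_measurable.
  apply: AA_setI => //; first by apply: AA_le; exact: cond_exp_measurable.
  have := AA_le (fun x => (cmod (e x) ^+ 2)%:E) n; apply.
  under eq_fun do rewrite cmod_sq.
  by apply/measurable_EFinP/measurable_funD; exact: measurable_funX.
have A_fin n : (mu (A n) < +oo)%E.
  apply: le_lt_trans (mF n).2; apply: le_measure; rewrite ?inE//.
  - exact: AA_sub.2.
  - by apply: AA_sub.2; exact: (mF n).1.
  - by move=> x [].
have eq_n : {ae mu, forall x, forall n, A n x ->
    ((fine (a x) ^+ 2)%:E * c x = (cmod (e x) ^+ 2)%:E * a x)%E}.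
  apply: ae_foralln => n.
  apply: (local_equality AA_sub AA_sigma_finite mu_u mu_w (AA_n n) (A_fin n)
    (n := n%:R)) => //.
  - by move=> x [_ []].
  - by move=> x [_ [_ []]].
  - by move=> x [_ [_ [_]]].
  - by move=> f g Lf Lg Tf; exact: (p_hyponormal_kernel p_gt0 T_hypo).
have e0 := ccond_exp_eq0 AA_sub AA_sigma_finite uw_dom.
apply: filterS (filterI (filterI eq_n e0) (filterI ca (filterI m_a m_c))) => x.
move=> [[eqx ex] [cax [ma mc]]].
have zero : m x = 0%E -> ((cmod (e x)) ^+ 2)%:E = 0%E.
  by move=> /ex; rewrite /e => ->; rewrite ComplexField.Normc.normc0 expr0n.
have [ax|an] := eqVneq (a x) 0%E; first by rewrite ax mul0e zero// ma.
have [cx|cn] := eqVneq (c x) 0%E; first by rewrite cx mule0 zero// mc.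
have [ay cy] := fin_ca _ _ (a0 x) (c0 x) cax an cn.
have [N FN] := FT x.
have big (r : R) : exists n : nat, r <= n%:R.
  by exists (Num.truncn r).+1; exact/ltW/truncnS_gt.
have [n1 h1] := big (fine (a x)); have [n2 h2] := big (fine (c x)).
have [n3 h3] := big (cmod (e x) ^+ 2).
have afin : a x \is a fin_num by rewrite ge0_fin_numE.
have cfin : c x \is a fin_num by rewrite ge0_fin_numE.
have := eqx (maxn N (maxn n1 (maxn n2 n3))).
have le_nat (r : R) k l : r <= k%:R -> (k <= l)%N -> r <= l%:R.
  by move=> rk kl; apply: le_trans rk _; rewrite ler_nat.
have -> : A (maxn N (maxn n1 (maxn n2 n3))) x = True.
  apply/propext; split => // _; split; first by apply: FN; rewrite leq_maxl.
  split.
    by rewrite /= -(fineK afin) lee_fin (le_nat _ _ _ h1)// !leq_max leqnn orbT.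
  split.
    by rewrite /= -(fineK cfin) lee_fin (le_nat _ _ _ h2)// !leq_max leqnn !orbT.
  by rewrite /= (le_nat _ _ _ h3)// !leq_max leqnn !orbT.
move=> /(_ Logic.I); rewrite -(fineK afin) -(fineK cfin) -!EFinM => -[].
move=> E1; congr (_%:E).
have fa0 : fine (a x) != 0 by apply: contra an => /eqP fa; rewrite -(fineK afin) fa.
apply: (mulIf fa0); rewrite -E1 /=; ring.
Qed.
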